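(* Work in discrete time, $\mathbb{T}=\mathbb{N}$. Assume that the environment $\omega$ is translation invariant, that the jump function $g$ is uniformly elliptic, and that $\omega$ satisfies the mixing property $\mathcal{D}_{\mathbb{N}}(c_0,2R+3,1,\alpha)$ for some parameters $c_0>0$ and $\alpha>11$. Let $(X_n)_{n\in\mathbb{N}}$ be the random walk in environment $\omega$ starting at $(0,0)$. Then there exists $\nu\in[-R,R]$ such that $$\mathbb{P}\text{-almost surely},\quad \frac{X_n}{n}\xrightarrow[n\to\infty]{}\nu .$$ Moreover, for every $\varepsilon>0$ there exists $c=c(\varepsilon)>0$ such that for every integer $n\geq 1$, $$\mathbb{P}\left(\left|\frac{X_n}{n}-\nu\right|\geq\varepsilon\right)\leq c\,n^{-\alpha/4}.$$
   Context: $\mathbb{N}=\{0,1,2,\dots\}$, $\mathbb{N}^*=\mathbb{N}\setminus\{0\}$, and $\llbracket n,m\rrbracket$ is the set of integers in $[n,m]$. Let $\mathbb{T}=\mathbb{N}$ and $\mathbb{L}=\mathbb{Z}\times\mathbb{T}$. Environment: let $S$ be a topological space and $(\Omega,\mathcal{T},\mathrm{P})$ a probability space with expectation $\mathrm{E}$. A random environment is a random variable $\omega$ on it taking values in the set of functions $\mathbb{T}\to S^{\mathbb{Z}}$ ($S^{\mathbb{Z}}$ has the product topology and the corresponding Borel $\sigma$-algebra); $\omega_t(x)\in S$ is the state at time $t$ and site $x$. For $A\subset\mathbb{L}$, $\omega|_A=\{\omega_t(x):(x,t)\in A\}$. Random walk: fix $\ell,R\in\mathbb{N}^*$ and a measurable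 jump function $g:S^{\llbracket-\ell,\ell\rrbracket}\times[0,1]\to\llbracket-R,R\rrbracket$. Let $(U_n^x)_{n\in\mathbb{N},x\in\mathbb{Z}}$ be independent uniform random variables in $[0,1]$ on a probability space $(\Omega',\mathcal{T}',\mathrm{P}')$, and let $\mathbb{P}=\mathrm{P}\otimes\mathrm{P}'$ on $\Omega\times\Omega'$ (so they are independent of $\omega$). The random walk in environment $\omega$ starting at $(0,0)$ is defined by $X_0=0$ and, for $n\in\mathbb{N}$, $$X_{n+1}=X_n+g\left(\omega_n(X_n-\ell),\ldots,\omega_n(X_n+\ell),U_n^{X_n}\right).$$ Translation invariance: for every $(x_0,t_0)\in\mathbb{L}$, $(\omega_t(x))_{(x,t)\in\mathbb{L}}$ and $(\omega_{t_0+t}(x_0+x))_{(x,t)\in\mathbb{L}}$ have the same law. Uniform ellipticity: there is a constant $\gamma>0$ such that, if $U$ is uniform in $[0,1]$ under $\mathbb{P}$, $\inf_{x\in\llbracket-R,R\rrbracket}\inf_{\sigma_{-\ell},\ldots,\sigma_\ell\in S}\mathbb{P}(g(\sigma_{-\ell},\ldots,\sigma_\ell,U)=x)\geq\gamma$. Mixing: a box is a set $B=[a_1,b_1)\times[a_2,b_2)\subseteq\mathbb{R}^2$ with $a_i<b_i$ (first coordinate is space, second is time); $\mathrm{diam}(B)=b_1-a_1$, $h(B)=b_2-a_2$. For $B=[a_1,b_1)\times[a_2,b_2)$ and $B'=[a_1',b_1')\times[a_2',b_2')$, $\mathrm{sep}(B,B')$ equals $a_2-b_2'$ if $b_2'<a_2$,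 equals $a_2'-b_2$ if $b_2<a_2'$, and equals $0$ otherwise. For $c_0,a,b,\alpha>0$, $\mathcal{D}_{\mathbb{T}}(c_0,a,b,\alpha)$ is the property: for every $H>0$, every pair of boxes $B,B'$ with $\max(\mathrm{diam}(B),\mathrm{diam}(B'))\leq aH$, $\max(h(B),h(B'))\leq bH$, $\mathrm{sep}(B,B')\geq H$, and every pair of $\{0,1\}$-valued functions $f_1,f_2$ on $(S^{\mathbb{Z}})^{\mathbb{T}}$ such that $f_1(\omega)$ is $\sigma(\omega|_{B\cap\mathbb{L}})$-measurable and $f_2(\omega)$ is $\sigma(\omega|_{B'\cap\mathbb{L}})$-measurable, $$\mathrm{E}[f_1(\omega)f_2(\omega)]\leq\mathrm{E}[f_1(\omega)]\,\mathrm{E}[f_2(\omega)]+c_0H^{-\alpha}.$$ *)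

(* Defs.v *)
From mathcomp Require Import all_boot all_order all_algebra.
From mathcomp Require Import all_classical all_reals all_analysis.

Set Implicit Arguments.
Unset Strict Implicit.
Unset Printing Implicit Defensive.

Import Order.TTheory GRing.Theory Num.Theory.
Import numFieldNormedType.Exports.

Local Open Scope classical_set_scope.
Local Open Scope ring_scope.

Section Environment.
Context (S : ptopologicalType).

(* S^I with the Borel sigma-algebra of the product topology, which is larger
   in general than the product of the Borel sigma-algebras when S is not second
   countable. *)
Definition borel_fun (I : Type) : Type :=
  @g_sigma_algebraType (I -> S) (@open (prod_topology (fun _ : I => S))).

(* The set of functions from times nat to S^Z carries the countable product of
   the Borel sigma-algebras of S^Z. *)
Definition env_gen : set (set (nat -> int -> S)) :=
  \bigcup_(t in [set: nat])
    preimage_set_system setT (fun e : nat -> int -> S => e t : borel_fun int)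
      measurable.

Definition env : Type := g_sigma_algebraType env_gen.

Definition shift_env (x0 : int) (t0 : nat) (e : env) : env :=
  fun t x => e (t0 + t)%N (x0 + x).

Definition translation_invariant d (Omega : measurableType d) (R : realType)
    (P : probability Omega R) (omega : {mfun Omega >-> env}) : Prop :=
  forall (x0 : int) (t0 : nat) (A : set env), measurable A ->
    pushforward P omega A = pushforward P (shift_env x0 t0 \o omega) A.

(* Generators of sigma(omega|_A): the slice of omega|_A at time t is a random
   element of S^{x | (x, t) in A}, a space carrying the product topology. *)
Definition restr_gen (Omega : Type) (omega : Omega -> env)
    (A : set (int * nat)) : set (set Omega) :=
  \bigcup_(t in [set: nat])
    preimage_set_system setT
      (fun w => (fun x : {x : int | A (x, t)} => omega w t (sval x))
                  : borel_fun {x : int | A (x, t)})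
      measurable.

Definition restr_measurable d (Omega : measurableType d)
    (omega : Omega -> env) (A : set (int * nat)) (h : Omega -> bool) : Prop :=
  measurable_fun setT (h : g_sigma_algebraType (restr_gen omega A) -> bool).

End Environment.

Section Boxes.
Context (R : realType).

(* [xmin, xmax) x [tmin, tmax) *)
Record box := Box {
  xmin : R; xmax : R; tmin : R; tmax : R;
  box_space : xmin < xmax;
  box_time : tmin < tmax }.

Definition box_diam (B : box) : R := xmax B - xmin B.
Definition box_height (B : box) : R := tmax B - tmin B.

Definition box_sep (B B' : box) : R :=
  if tmax B' < tmin B then tmin B - tmax B'
  else if tmax B < tmin B' then tmin B' - tmax B
  else 0.

Definition box_sites (B : box) : set (int * nat) :=
  [set p | xmin B <= p.1%:~R < xmax B /\ tmin B <= p.2%:R < tmax B].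

End Boxes.

Definition mixing (S : ptopologicalType) d (Omega : measurableType d)
    (R : realType) (P : probability Omega R) (omega : Omega -> env S)
    (c0 a b alpha : R) : Prop :=
  forall (H : R) (B B' : box R), 0 < H ->
    Num.max (box_diam B) (box_diam B') <= a * H ->
    Num.max (box_height B) (box_height B') <= b * H ->
    H <= box_sep B B' ->
  forall f1 f2 : env S -> bool,
    restr_measurable omega (box_sites B) (f1 \o omega) ->
    restr_measurable omega (box_sites B') (f2 \o omega) ->
    ('E_P[(fun w => (f1 (omega w))%:R * (f2 (omega w))%:R)%R]
     <= 'E_P[(fun w => (f1 (omega w))%:R)%R]
        * 'E_P[(fun w => (f2 (omega w))%:R)%R]
        + (c0 * H `^ (- alpha))%:E)%E.

Definition mutually_independent d (Omega : measurableType d) (R : realType)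
    (P : probability Omega R) (I : choiceType) (X : I -> {RV P >-> R}) : Prop :=
  forall (s : seq I) (A : I -> set R), uniq s ->
    (forall i, i \in s -> measurable (A i)) ->
    P (\bigcap_(i in [set` s]) (X i @^-1` A i))
    = (\prod_(i <- s) P (X i @^-1` A i))%E.

Section Walk.
Context (S : ptopologicalType) (R : realType) (l : nat).

(* S^{-l, ..., l}: the index i of the (2l+1)-tuple is the offset i - l. *)
Definition window : Type := borel_fun S 'I_(l.*2.+1).

Definition view (e : env S) (n : nat) (x : int) : window :=
  fun i => e n (x - l%:Z + (i : nat)%:Z).

(* A function from S^{-l, ..., l} x [0, 1] to {-r, ..., r} is represented by a
   total g, about which nothing is said when the second argument is outside
   [0, 1]. *)
Definition jump_function (r : nat) (g : window -> R -> int) : Prop :=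
  (forall (s : window) (u : R), u \in `[0, 1] -> - r%:Z <= g s u <= r%:Z) /\
  (forall k : int,
     measurable ((setT `*` `[0, 1]) `&`
       [set p : window * measurableTypeR R | g p.1 p.2 = k])).

Definition jump_prob (g : window -> R -> int) (s : window) (x : int) : \bar R :=
  uniform_prob (@ltr01 R) (`[0, 1] `&` [set u : R | g s u = x]).

Definition uniformly_elliptic (r : nat) (g : window -> R -> int) : Prop :=
  exists2 gamma : R, 0 < gamma &
    (gamma%:E <= ereal_inf
      [set ereal_inf [set jump_prob g s x | s in [set: window]]
         | x in [set x : int | (- r%:Z <= x <= r%:Z)%R]])%E.

Fixpoint walk (g : window -> R -> int) (e : env S) (u : nat -> int -> R)
    (n : nat) : int :=
  if n is m.+1 then
    let x := walk g e u m in x + g (view e m x) (u m x)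
  else 0.

End Walk.

(* Main.v *)
Require Import Defs.
From mathcomp Require Import all_boot all_order all_algebra.
From mathcomp Require Import all_classical all_reals all_analysis.
From HB Require Import structures.
From mathcomp Require Import measurable_realfun.
From mathcomp Require Import zify ring lra.

Set Implicit Arguments.
Unset Strict Implicit.
Unset Printing Implicit Defensive.

Import Order.TTheory GRing.Theory Num.Theory.
Import numFieldNormedType.Exports.

Local Open Scope classical_set_scope.
Local Open Scope ring_scope.

(** In a fixed environment the walk is a Markov chain: from [x] at time [n] it
    makes the jump [j] with probability [k n x j], where [k] depends on the
    environment near [(x, n)] only.  The law of [X n] given the environment is
    the operator [quenched], and its probabilities are polynomials in finitely
    many values of [k].  Translation invariance, mixing and ellipticity are
    used only through the expectations of such polynomials
    ([kernel_expectation]); the reflection [x |-> - x] preserves this setting.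

    Write [p H v] for the probability that [X H >= v * H] ([fast_prob]), and
    let [v+] be the infimum of the [v] such that [p H v] is
    [O (H `^ - (alpha / 4))].  It suffices to prove that [v+ + mu+ <= 0], where
    [mu+] is the same number for the reflected walk: then [nu = v+] satisfies
    the deviation bound on both sides, and almost sure convergence follows by
    Borel-Cantelli since [alpha / 4 > 2].

    Quasi-monotonicity.  Walks with jumps of size up to [r] may jump over each
    other, but when a walk overtakes another one it could instead have landed
    on it, and ellipticity gives this alternative probability at least [gamma].
    Hence, up to the factor [gamma], the probability of being behind a given
    point is monotone in the starting point
    ([quenched_quasi_nonincreasing]).  This replaces the non-crossing property
    of nearest-neighbour walks: all starting points in a window can be
    controlled by its endpoint.

    Renormalization.  If the walk is faster than [v] by [O(1 / q)] over [q]
    slabs of time of height [H], it must be faster than [v] in two slabs that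
    are not adjacent, and mixing makes these two events almost independent:
    [p (q * H) (v + O(1 / q)) <= C q ^ 6 (p H v ^ 2 + c0 H ^ - alpha)]
    ([fast_prob_recursion]).  Iterating with [q = L, 2 L, 4 L, ...] gives the
    polynomial decay above [v + O(1 / L)] as soon as [p H v] is at most
    [trigger_level L], a power of [1 / L], at one single large [H]
    ([fast_prob_decay]).  In particular, for [v < v+], [p H v] is bounded away
    from 0 as [H] goes to infinity.

    Traps.  Suppose that [v+ + mu+ > 0].  At every large scale [H] the walk has
    probability bounded below to be delayed by a positive fraction of [H] with
    respect to speed [v+], and by quasi-monotonicity the walk is delayed with
    comparable probability when it starts anywhere behind such a point.
    Consider traps along a line of speed slightly above [v+], in [2 ^ m] of
    [3 ^ m] consecutive slabs chosen as in a Cantor set so that mixing applies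
    between groups of traps.  The walk cannot pass ahead of the line, and once
    delayed it cannot catch up, because it would have to be faster than [v+] in
    some slab; and it avoids all the traps with probability at most
    [(1 - gamma * c) ^ (2 ^ m)] ([escape_small]).  So [p H v] at the scale
    [3 ^ m * H], for [v] below [v+] by a constant over [3 ^ m], is
    superpolynomially small in [3 ^ m]; it falls below the trigger level with
    [L] of order [3 ^ m], and renormalization yields the decay at a speed
    smaller than [v+], a contradiction ([top_speeds_le0]). *)

(** * Random walks in a fixed environment *)

Section QuenchedWalk.
Context (R : realType) (r : nat).

Definition kernel : Type := nat -> int -> 'I_(r.*2.+1) -> R.

Definition jump (i : 'I_(r.*2.+1)) : int := (i : nat)%:Z - r%:Z.

Definition elliptic (gamma : R) (k : kernel) : Prop :=
  forall n x, (forall i, gamma <= k n x i) /\ \sum_i k n x i = 1.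

(** Expectation of [phi] at the position at time [n + H] of the walk that is at
    [x] at time [n]. *)
Fixpoint quenched (k : kernel) (H n : nat) (phi : int -> R) (x : int) : R :=
  if H is H'.+1 then
    \sum_i k n x i * quenched k H' n.+1 phi (x + jump i)
  else phi x.

Definition shift_kernel (x0 : int) (t0 : nat) (k : kernel) : kernel :=
  fun n x i => k (t0 + n)%N (x0 + x) i.

Definition flip_kernel (k : kernel) : kernel :=
  fun n x i => k n (- x) (rev_ord i).

Lemma jump_bound i : - r%:Z <= jump i <= r%:Z.
Proof. by rewrite /jump; case: i => i /= Hi; lia. Qed.

Lemma jump_surj (z : int) : - r%:Z <= z <= r%:Z -> exists i, jump i = z.
Proof.
move=> Hz; have Hi : (absz (z + r%:Z)%R < r.*2.+1)%N by lia.
by exists (Ordinal Hi); rewrite /jump /=; lia.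
Qed.

Lemma jump_rev i : jump (rev_ord i) = - jump i.
Proof. by rewrite /jump /=; case: i => i /= Hi; lia. Qed.

Lemma quenched_add k H1 H2 n phi x :
  quenched k (H1 + H2) n phi x =
  quenched k H1 n (quenched k H2 (n + H1) phi) x.
Proof.
elim: H1 n x => [|H1 IH] n x /=; first by rewrite addn0.
by apply: eq_bigr => i _; rewrite IH addSnnS.
Qed.

Lemma quenched_shift k x0 t0 H n phi x :
  quenched (shift_kernel x0 t0 k) H n phi x =
  quenched k H (t0 + n) (fun y => phi (y - x0)) (x0 + x).
Proof.
elim: H n x => [|H IH] n x /=; first by congr phi; lia.
by apply: eq_bigr => i _; rewrite IH addnS addrA.
Qed.

Lemma quenched_flip k H n phi x :
  quenched (flip_kernel k) H n phi x =
  quenched k H n (fun y => phi (- y)) (- x).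
Proof.
elim: H n x => [|H IH] n x /=; first by rewrite opprK.
rewrite (reindex_inj rev_ord_inj) /=; apply: eq_bigr => i _.
by rewrite /flip_kernel rev_ordK IH jump_rev opprD opprK.
Qed.

Lemma elliptic_flip gamma k : elliptic gamma k -> elliptic gamma (flip_kernel k).
Proof.
move=> kP n x; split=> [i|]; first by case: (kP n (- x)) => + _; exact.
by rewrite -[RHS](kP n (- x)).2 [RHS](reindex_inj rev_ord_inj).
Qed.

Section Elliptic.
Context (gamma : R) (gamma_gt0 : 0 < gamma).
Context (k : kernel) (kP : elliptic gamma k).

Lemma kernel_ge0 n x i : 0 <= k n x i.
Proof. by rewrite (le_trans (ltW gamma_gt0)) ?(kP n x).1. Qed.

Lemma kernel_le1 n x i : k n x i <= 1.
Proof.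
rewrite -(kP n x).2 (bigD1 i) //= lerDl sumr_ge0 // => j _.
exact: kernel_ge0.
Qed.

Lemma gamma_le1 : gamma <= 1.
Proof. exact: le_trans ((kP 0%N 0).1 ord0) (kernel_le1 _ _ _). Qed.

(** The walk moves by at most [r] at each step, so only the values of [phi]
    and [psi] in the light cone matter. *)
Lemma quenched_le H n phi psi x :
  (forall y, x - (r * H)%:Z <= y <= x + (r * H)%:Z -> phi y <= psi y) ->
  quenched k H n phi x <= quenched k H n psi x.
Proof.
elim: H n x => [|H IH] n x Hy /=; first by apply: Hy; lia.
apply: ler_sum => i _; apply: ler_wpM2l; first exact: kernel_ge0.
by apply: IH => y Hyy; apply: Hy; have := jump_bound i; lia.
Qed.

Lemma quenched_cst H n c x : quenched k H n (fun=> c) x = c.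
Proof.
elim: H n x => [//|H IH] n x /=.
under eq_bigr do rewrite IH.
by rewrite -mulr_suml (kP n x).2 mul1r.
Qed.

Lemma quenchedD H n phi psi x :
  quenched k H n (fun y => phi y + psi y) x =
  quenched k H n phi x + quenched k H n psi x.
Proof.
elim: H n x => [//|H IH] n x /=.
by rewrite -big_split; apply: eq_bigr => i _ /=; rewrite IH mulrDr.
Qed.

Lemma quenchedZ H n c phi x :
  quenched k H n (fun y => c * phi y) x = c * quenched k H n phi x.
Proof.
elim: H n x => [//|H IH] n x /=.
by rewrite mulr_sumr; apply: eq_bigr => i _ /=; rewrite IH mulrCA.
Qed.

(** The quasi-monotonicity that replaces the non-crossing of nearest-neighbour
    walks.  Two walks started at [x <= y] may jump over each other, but at the
    step where the first one overtakes the second one it could have landed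
    exactly at the new position of the second one, which by ellipticity has
    probability at least [gamma]; afterwards both have the same future. *)
Lemma quenched_quasi_nonincreasing H n phi :
  (forall x, 0 <= phi x) -> {homo phi : x y /~ x <= y} ->
  forall x y, x <= y ->
    gamma * quenched k H n phi y <= quenched k H n phi x.
Proof.
move=> phi0 phi_homo; have q0 H' n' x' : 0 <= quenched k H' n' phi x'.
  by rewrite -[leLHS](quenched_cst H' n' 0 x'); apply: quenched_le => *.
elim: H n => [|H IH] n x y xy /=.
  rewrite -[leRHS]mul1r ler_pM ?(ltW gamma_gt0) ?gamma_le1 ?phi0 //.
  exact: phi_homo.
suff step z : y - r%:Z <= z ->
    gamma * quenched k H n.+1 phi z <=
    \sum_i k n x i * quenched k H n.+1 phi (x + jump i).
  rewrite -[leRHS]mul1r -(kP n y).2 mulr_sumr mulr_suml.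
  apply: ler_sum => i _; rewrite mulrCA ler_wpM2l ?kernel_ge0 //.
  by apply: step; have := jump_bound i; lia.
move=> yz; have [xz|xz] := lerP (x + r%:Z) z.
  rewrite -[leLHS]mul1r -(kP n x).2 mulr_suml; apply: ler_sum => i _.
  rewrite ler_wpM2l ?kernel_ge0 //; apply: IH.
  by have := jump_bound i; lia.
have [i Hi] : exists i, jump i = z - x by apply: jump_surj; lia.
have -> : z = x + jump i by rewrite Hi; lia.
rewrite (bigD1 i) //= -[leLHS]addr0; apply: lerD.
  by rewrite ler_wpM2r ?(kP n x).1.
by apply: sumr_ge0 => j _; rewrite mulr_ge0 ?kernel_ge0.
Qed.

End Elliptic.

Lemma quenched_quasi_nondecreasing gamma k H n phi :
  0 < gamma -> elliptic gamma k ->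
  (forall x, 0 <= phi x) -> {homo phi : x y / x <= y} ->
  forall x y, y <= x ->
    gamma * quenched k H n phi y <= quenched k H n phi x.
Proof.
move=> g0 kP phi0 phi_homo x y yx.
have := @quenched_quasi_nonincreasing _ g0 _ (elliptic_flip kP) H n
  (fun y => phi (- y)) (fun x => phi0 _) _ (- x) (- y).
rewrite !quenched_flip !opprK lerN2 => /(_ _ yx).
under [X in quenched k H n X]eq_fun do rewrite opprK.
by apply=> a b ab; apply: phi_homo; rewrite lerN2.
Qed.

End QuenchedWalk.

(** * Expectations of polynomial functionals of a random kernel *)

Section RandomKernel.
Context (R : realType) (r : nat).

(** All the quenched probabilities used below are of this form, which settles
    at once their measurability, their boundedness and the part of the
    environment that they depend on. *)
Inductive polynomial (D : nat -> int -> Prop) : (kernel R r -> R) -> Prop :=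
| polynomial_cst c : polynomial D (fun=> c)
| polynomial_coord n x i : D n x -> polynomial D (fun k => k n x i)
| polynomialD f g : polynomial D f -> polynomial D g ->
    polynomial D (fun k => f k + g k)
| polynomialM f g : polynomial D f -> polynomial D g ->
    polynomial D (fun k => f k * g k).

Definition everywhere (n : nat) (x : int) : Prop := True.

Definition in_box (a b : int) (s t n : nat) (x : int) : Prop :=
  (a <= x <= b) /\ (s <= n < t)%N.

Lemma polynomial_sub (D D' : nat -> int -> Prop) f :
  (forall n x, D n x -> D' n x) -> polynomial D f -> polynomial D' f.
Proof.
move=> DD'; elim=> [c|n x i Dnx|f1 f2 _ H1 _ H2|f1 f2 _ H1 _ H2].
- exact: polynomial_cst.
- by apply: polynomial_coord; exact: DD'.
- exact: polynomialD.
- exact: polynomialM.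
Qed.

Lemma polynomial_everywhere D f : polynomial D f -> polynomial everywhere f.
Proof. exact: polynomial_sub. Qed.

Lemma polynomialZ D c f : polynomial D f -> polynomial D (fun k => c * f k).
Proof. by move=> Df; apply: polynomialM => //; exact: polynomial_cst. Qed.

Lemma polynomialBC D c f : polynomial D f -> polynomial D (fun k => c - f k).
Proof.
move=> Df; have -> : (fun k => c - f k) = (fun k => c + (-1) * f k).
  by apply/funext => k; rewrite mulN1r.
by apply: polynomialD; [exact: polynomial_cst|exact: polynomialZ].
Qed.

Lemma polynomial_sum (I : Type) (s : seq I) D (F : I -> kernel R r -> R) :
  (forall i, polynomial D (F i)) ->
  polynomial D (fun k => \sum_(i <- s) F i k).
Proof.
move=> FD; elim: s => [|i s IH].
  by under eq_fun do rewrite big_nil; exact: polynomial_cst.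
by under eq_fun do rewrite big_cons; exact: polynomialD.
Qed.

Lemma polynomial_quenched H n phi x :
  polynomial (in_box (x - (r * H)%:Z) (x + (r * H)%:Z) n (n + H))
    (fun k => quenched k H n phi x).
Proof.
elim: H n x => [|H IH] n x /=; first exact: polynomial_cst.
apply: polynomial_sum => i; apply: polynomialM.
  by apply: polynomial_coord; split; lia.
by apply: polynomial_sub (IH n.+1 (x + jump i)) => m y [Hy Hm]; split;
  have := jump_bound i; lia.
Qed.

Lemma polynomial_flip D f : polynomial D f ->
  polynomial (fun n x => D n (- x)) (fun k => f (flip_kernel k)).
Proof.
elim=> [c|n x i Dnx|f1 f2 _ H1 _ H2|f1 f2 _ H1 _ H2].
- exact: polynomial_cst.
- by apply: (polynomial_coord (D := fun n x => D n (- x))); rewrite opprK.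
- exact: polynomialD.
- exact: polynomialM.
Qed.

(** All that is used of the law of the environment.  Abstracting from the
    environment makes the setting stable under reflection, so that the bounds
    on fast walks also apply to slow ones. *)
Record kernel_expectation (gamma : R) (l : nat) (err : nat -> R)
    (E : (kernel R r -> R) -> R) : Prop := KernelExpectation {
  expect_cst c : E (fun=> c) = c;
  expectD f g : polynomial everywhere f -> polynomial everywhere g ->
    E (fun k => f k + g k) = E f + E g;
  expectZ c f : polynomial everywhere f -> E (fun k => c * f k) = c * E f;
  expect_le f g : polynomial everywhere f -> polynomial everywhere g ->
    (forall k, elliptic gamma k -> f k <= g k) -> E f <= E g;
  expect_shift x0 t0 f : polynomial everywhere f ->
    E (fun k => f (shift_kernel x0 t0 k)) = E f;
  expect_mix H a a' s s' f g : (l < H)%N -> (s + 2 * H <= s')%N ->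
    polynomial (in_box a (a + ((2 * r + 1) * H)%:Z) s (s + H)) f ->
    polynomial (in_box a' (a' + ((2 * r + 1) * H)%:Z) s' (s' + H)) g ->
    (forall k, elliptic gamma k -> 0 <= f k <= 1) ->
    (forall k, elliptic gamma k -> 0 <= g k <= 1) ->
    E (fun k => f k * g k) <= E f * E g + err H }.

Lemma shift_flip x0 t0 (k : kernel R r) :
  flip_kernel (shift_kernel x0 t0 k) = shift_kernel (- x0) t0 (flip_kernel k).
Proof.
apply/funext => n; apply/funext => x; apply/funext => i.
by rewrite /flip_kernel /shift_kernel opprD opprK.
Qed.

Lemma kernel_expectation_flip gamma l err E :
  kernel_expectation gamma l err E ->
  kernel_expectation gamma l err (fun f => E (fun k => f (flip_kernel k))).
Proof.
move=> EP.
have pe f : polynomial everywhere f ->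
    polynomial everywhere (fun k => f (flip_kernel k)).
  by move/polynomial_flip; exact: polynomial_everywhere.
split.
- by move=> c; exact: (expect_cst EP).
- by move=> f g /pe ? /pe ?; exact: (expectD EP).
- by move=> c f /pe ?; exact: (expectZ EP).
- move=> f g /pe ? /pe ? fg; apply: (expect_le EP) => // k kP.
  by apply: fg; exact: elliptic_flip.
- move=> x0 t0 f /pe fp; rewrite -(expect_shift EP (- x0) t0 fp).
  by congr E; apply/funext => k; rewrite shift_flip opprK.
- move=> H a a' s s' f g lH ss' fp gp f01 g01.
  apply: (expect_mix EP (f := fun k => f (flip_kernel k))
    (g := fun k => g (flip_kernel k)) lH ss' (a := - a - ((2 * r + 1) * H)%:Z)
    (a' := - a' - ((2 * r + 1) * H)%:Z)).
  + apply: polynomial_sub (polynomial_flip fp) => n x [h1 h2]; split; lia.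
  + apply: polynomial_sub (polynomial_flip gp) => n x [h1 h2]; split; lia.
  + by move=> k kP; apply: f01; exact: elliptic_flip.
  + by move=> k kP; apply: g01; exact: elliptic_flip.
Qed.

Definition ahead (k : kernel R r) (H n : nat) (x : int) (b : R) : R :=
  quenched k H n (fun y => (b <= y%:~R)%R%:R) x.

(** Probability, averaged over the environment, that [X H >= v * H]. *)
Definition fast_prob (E : (kernel R r -> R) -> R) (H : nat) (v : R) : R :=
  E (fun k => ahead k H 0 0 (v * H%:R)).

Lemma ahead_shift k H n x b :
  ahead k H n x b = ahead (shift_kernel x n k) H 0 0 (b - x%:~R).
Proof.
rewrite /ahead quenched_shift addn0 addr0; congr quenched.
by apply/funext => y; rewrite rmorphB /= lerD2r.
Qed.

Lemma polynomial_ahead H n (x : int) b :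
  polynomial (in_box (x - (r * H)%:Z) (x + (r * H)%:Z) n (n + H))
    (fun k => ahead k H n x b).
Proof. exact: polynomial_quenched. Qed.

Lemma polynomial_ahead_everywhere H n (x : int) b :
  polynomial everywhere (fun k => ahead k H n x b).
Proof. exact: polynomial_everywhere (polynomial_ahead H n x b). Qed.

Lemma expect_ahead gamma l err E H n x v :
  kernel_expectation gamma l err E ->
  E (fun k => ahead k H n x (x%:~R + v * H%:R)) = fast_prob E H v.
Proof.
move=> EP; rewrite /fast_prob.
rewrite -(expect_shift EP x n (f := fun k => ahead k H 0 0 (v * H%:R))).
  by congr E; apply/funext => k; rewrite ahead_shift addrAC subrr add0r.
exact: polynomial_ahead_everywhere.
Qed.

Section Ahead.
Context (gamma : R) (gamma_gt0 : 0 < gamma).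
Context (k : kernel R r) (kP : elliptic gamma k).

Lemma quenched_01 H n (phi : int -> R) x :
  (forall y, 0 <= phi y <= 1) -> 0 <= quenched k H n phi x <= 1.
Proof.
move=> phi01; apply/andP; split.
  rewrite -[leLHS](quenched_cst kP H n 0 x); apply: (quenched_le gamma_gt0 kP).
  by move=> y _; have /andP[] := phi01 y.
rewrite -[leRHS](quenched_cst kP H n 1 x); apply: (quenched_le gamma_gt0 kP).
by move=> y _; have /andP[] := phi01 y.
Qed.

Lemma indic_01 (b : bool) : 0 <= (b%:R : R) <= 1.
Proof. by case: b; rewrite lexx ler01. Qed.

Lemma ahead_01 H n x b : 0 <= ahead k H n x b <= 1.
Proof. by apply: quenched_01 => y; exact: indic_01. Qed.

Lemma ahead_mono H n x b b' : b <= b' -> ahead k H n x b' <= ahead k H n x b.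
Proof.
move=> bb'; apply: (quenched_le gamma_gt0 kP) => y _.
by rewrite ler_nat; case: (lerP b' _) => // /(le_trans bb') ->.
Qed.

Lemma ahead_quasi_mono H n x y b : x <= y ->
  ahead k H n x b <= gamma^-1 * ahead k H n y b.
Proof.
move=> xy; rewrite -ler_pdivrMl ?invr_gt0 // invrK.
apply: (quenched_quasi_nondecreasing (gamma := gamma)) => //.
move=> a c ac; rewrite ler_nat; case: (lerP b _) => // ba.
by rewrite (le_trans ba) // ler_int.
Qed.

Lemma ahead_eq0 H n x b : x%:~R + (r * H)%:R < b -> ahead k H n x b = 0.
Proof.
move=> xb; apply/le_anti; have /andP[-> _] := ahead_01 H n x b; rewrite andbT.
rewrite -[leRHS](quenched_cst kP H n 0 x).
apply: (quenched_le gamma_gt0 kP) => y /andP[_ yx].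
rewrite lern0 eqb0 -ltNge (le_lt_trans _ xb) //.
by rewrite -[(r * H)%:R]/((r * H)%:Z%:~R) -rmorphD /= ler_int.
Qed.

Lemma ahead_add H1 H2 n x b :
  ahead k (H1 + H2) n x b = quenched k H1 n (fun y => ahead k H2 (n + H1) y b) x.
Proof. exact: quenched_add. Qed.

End Ahead.
End RandomKernel.

(** * Slabs and windows *)

Section Slabs.
Context (R : realType) (r : nat) (gamma : R) (gamma_gt0 : 0 < gamma).
Context (k : kernel R r) (kP : elliptic gamma k).

(** Union bounds over slabs of height [H]: if [s n] bounds the probability of
    being fast in the slab that starts at time [n], then [slab_sum] bounds the
    probability of one fast slab among [m], and [slab_pair_sum] that of two fast
    slabs with at least one slab in between. *)
Fixpoint slab_sum (s : nat -> R) (H m n : nat) : R :=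
  if m is m'.+1 then s n + slab_sum s H m' (n + H) else 0.

Fixpoint slab_pair_sum (s : nat -> R) (H m n : nat) : R :=
  if m is m'.+1 then
    s n * slab_sum s H m'.-1 (n + H + H) + slab_pair_sum s H m' (n + H)
  else 0.

Lemma slab_sum_ge0 s H m n : (forall n, 0 <= s n) -> 0 <= slab_sum s H m n.
Proof. by move=> s0; elim: m n => //= m IH n; rewrite addr_ge0. Qed.

Lemma slab_pair_sum_ge0 s H m n :
  (forall n, 0 <= s n) -> 0 <= slab_pair_sum s H m n.
Proof.
move=> s0; elim: m n => //= m IH n.
by rewrite addr_ge0 ?mulr_ge0 ?slab_sum_ge0.
Qed.

Lemma intr_le_nat (x : int) (a : int) (n : nat) :
  x <= a + n%:Z -> x%:~R <= a%:~R + n%:R :> R.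
Proof. by move=> xa; rewrite -[n%:R]/(n%:Z%:~R) -rmorphD /= ler_int. Qed.

Section Counting.
Context (s : nat -> R) (s_ge0 : forall n, 0 <= s n).
Context (H T rho : nat) (u B : R).
Context (fast_le : forall n x, - (r * n)%:Z <= x <= (r * n)%:Z ->
  (n + H <= T)%N -> ahead k H n x (x%:~R + u) <= s n).

(** A walk that must gain more than [u] per slab on average has a fast slab. *)
Lemma ahead_le_slab_sum m n x :
  - (r * n)%:Z <= x <= (r * n)%:Z -> (n + m * H <= T)%N ->
  x%:~R + m%:R * u + (r * rho)%:R < B ->
  ahead k (m * H + rho) n x B <= slab_sum s H m n.
Proof.
elim: m n x => [|m IH] n x xn nT xB /=.
  by rewrite mul0n add0n (ahead_eq0 gamma_gt0 kP) //; lra.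
have -> : (m.+1 * H + rho = H + (m * H + rho))%N by lia.
rewrite ahead_add.
have S0 := slab_sum_ge0 H m (n + H) s_ge0.
apply: (@le_trans _ _ (quenched k H n
   (fun y => (x%:~R + u <= y%:~R)%R%:R + slab_sum s H m (n + H)) x)).
  apply: (quenched_le gamma_gt0 kP) => y xy.
  case: (lerP (x%:~R + u) y%:~R) => yu /=.
    have /andP[_] := ahead_01 gamma_gt0 kP (m * H + rho) (n + H) y B.
    by move=> h; apply: (le_trans h); rewrite lerDl.
  rewrite add0r; apply: IH; [lia|lia|].
  by rewrite -natr1 mulrDl mul1r in xB; lra.
rewrite quenchedD (quenched_cst kP) lerD2r; apply: fast_le => //.
by rewrite mulSn in nT; lia.
Qed.

(** A first fast slab and the next one contribute at most two maximal
    displacements instead of two times [u], which the slack of four maximal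
    displacements absorbs; a second fast slab is needed afterwards. *)
Lemma ahead_le_slab_pair_sum m n x :
  - (r * H)%:R <= u ->
  - (r * n)%:Z <= x <= (r * n)%:Z -> (n + m * H <= T)%N ->
  x%:~R + m%:R * u + 4 * (r * H)%:R + (r * rho)%:R < B ->
  ahead k (m * H + rho) n x B <= slab_pair_sum s H m n.
Proof.
move=> u_ge; have rH0 : 0 <= (r * H)%:R :> R by [].
elim: m n x => [|m IH] n x xn nT xB /=.
  by rewrite mul0n add0n (ahead_eq0 gamma_gt0 kP) //; lra.
have -> : (m.+1 * H + rho = H + (m * H + rho))%N by lia.
rewrite ahead_add.
set S1 := slab_sum _ _ _ _; set S2 := slab_pair_sum _ _ _ _.
have S1_ge0 : 0 <= S1 by exact: slab_sum_ge0.
have S2_ge0 : 0 <= S2 by exact: slab_pair_sum_ge0.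
have fast y : y <= x + (r * H)%:Z -> - (r * (n + H))%:Z <= y ->
    ahead k (m * H + rho) (n + H) y B <= S1.
  move=> yx yn; have yx' := intr_le_nat yx.
  rewrite /S1; case: m nT xB {IH S1 S1_ge0 S2 S2_ge0} => [|m] nT xB /=.
    by rewrite mul0n add0n (ahead_eq0 gamma_gt0 kP) //; lra.
  have -> : (m.+1 * H + rho = H + (m * H + rho))%N by lia.
  rewrite ahead_add -[leRHS](quenched_cst kP H (n + H) _ y).
  apply: (quenched_le gamma_gt0 kP) => z /andP[zy1 zy2].
  have zy' := intr_le_nat zy2.
  apply: ahead_le_slab_sum; [lia|by rewrite !mulSn in nT; lia|].
  by rewrite -!natr1 !mulrDl !mul1r in xB; lra.
apply: (@le_trans _ _ (quenched k H n
   (fun y => S1 * (x%:~R + u <= y%:~R)%R%:R + S2) x)).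
  apply: (quenched_le gamma_gt0 kP) => y xy.
  case: (lerP (x%:~R + u) y%:~R) => yu /=.
    rewrite mulr1 (@le_trans _ _ S1) ?lerDl //; apply: fast; lia.
  rewrite mulr0 add0r; apply: IH; [lia|by rewrite mulSn in nT; lia|].
  by rewrite -natr1 mulrDl mul1r in xB; lra.
rewrite quenchedD (quenched_cst kP) lerD2r quenchedZ mulrC ler_wpM2r //.
by apply: fast_le => //; rewrite mulSn in nT; lia.
Qed.

End Counting.
End Slabs.

Section Windows.
Context (R : realType) (r : nat) (gamma : R) (gamma_gt0 : 0 < gamma).
Context (H W M : nat) (v : R).

Definition window_end (i : 'I_(M.*2.+1)) : int := ((i : nat)%:Z - M%:Z) * W%:Z.

(** Bounds the probability of being fast from any starting point in the range
    of [M] windows of width [W] on each side of the origin. *)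
Definition speeding (k : kernel R r) (n : nat) : R :=
  gamma^-1 * \sum_i
    ahead k H n (window_end i) ((window_end i)%:~R + v * H%:R).

Lemma speeding_ge0 k n : elliptic gamma k -> 0 <= speeding k n.
Proof.
move=> kP; rewrite mulr_ge0 ?invr_ge0 ?(ltW gamma_gt0) // sumr_ge0 // => i _.
by have /andP[] := ahead_01 gamma_gt0 kP H n (window_end i)
  ((window_end i)%:~R + v * H%:R).
Qed.

Lemma window_cover (x : int) : (0 < W)%N -> - (M * W)%:Z <= x <= (M * W)%:Z ->
  exists i, x <= window_end i <= x + W%:Z.
Proof.
move=> W0 xM; pose y := absz (x + (M * W)%:Z)%R.
have yx : y%:Z = x + (M * W)%:Z by rewrite /y; lia.
(* [d] is the index of the first window end on the right of [x] *)
have Hd := divn_eq (y + W.-1) W.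
have Hm := ltn_pmod (y + W.-1) W0.
set d := ((y + W.-1) %/ W)%N in Hd.
have dM : (d < M.*2.+1)%N.
  rewrite -(ltn_pmul2r W0) mulSn -muln2 mulnAC; lia.
exists (Ordinal dM); rewrite /window_end /= mulrBl -!PoszM; lia.
Qed.

Lemma ahead_le_speeding k n x u : elliptic gamma k -> (0 < W)%N ->
  - (M * W)%:Z <= x <= (M * W)%:Z -> v * H%:R + W%:R <= u ->
  ahead k H n x (x%:~R + u) <= speeding k n.
Proof.
move=> kP W0 xM vu; have [i /andP[xi ix]] := window_cover W0 xM.
have ix' := intr_le_nat R ix.
apply: le_trans (ahead_quasi_mono gamma_gt0 kP _ _ _ xi) _.
rewrite /speeding ler_wpM2l ?invr_ge0 ?(ltW gamma_gt0) // (bigD1 i) //=.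
rewrite -[leLHS]addr0; apply: lerD.
  by apply: (ahead_mono gamma_gt0 kP); lra.
apply: sumr_ge0 => j _.
by have /andP[] := ahead_01 gamma_gt0 kP H n (window_end j)
  ((window_end j)%:~R + v * H%:R).
Qed.

End Windows.

(** * The renormalization inequality *)

Section Recursion.
Context (R : realType) (r : nat) (gamma : R) (l : nat) (err : nat -> R).
Context (E : (kernel R r -> R) -> R).
Context (gamma_gt0 : 0 < gamma) (err_ge0 : forall H, 0 <= err H).
Context (EP : kernel_expectation gamma l err E).

Lemma expect_sum (I : Type) (s : seq I) (F : I -> kernel R r -> R) :
  (forall i, polynomial everywhere (F i)) ->
  E (fun k => \sum_(i <- s) F i k) = \sum_(i <- s) E (F i).
Proof.
move=> Fp; elim: s => [|i s IH].
  by rewrite big_nil; under eq_fun do rewrite big_nil; rewrite (expect_cst EP).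
rewrite big_cons -IH -(expectD EP) //; last exact: polynomial_sum.
by congr E; apply/funext => k; rewrite big_cons.
Qed.

Lemma fast_prob_01 H v : 0 <= fast_prob E H v <= 1.
Proof.
have p := @polynomial_ahead_everywhere R r H 0 0 (v * H%:R).
apply/andP; split.
  rewrite -[leLHS](expect_cst EP); apply: (expect_le EP) => //.
    exact: polynomial_cst.
  by move=> k kP; have /andP[] := ahead_01 gamma_gt0 kP H 0 0 (v * H%:R).
rewrite -[leRHS](expect_cst EP); apply: (expect_le EP) => //.
  exact: polynomial_cst.
by move=> k kP; have /andP[] := ahead_01 gamma_gt0 kP H 0 0 (v * H%:R).
Qed.

Lemma fast_prob_mono H v v' : v <= v' -> fast_prob E H v' <= fast_prob E H v.
Proof.
move=> vv'; apply: (expect_le EP).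
- exact: polynomial_ahead_everywhere.
- exact: polynomial_ahead_everywhere.
move=> k kP; apply: (ahead_mono gamma_gt0 kP).
by rewrite ler_wpM2r.
Qed.

Section Slabs.
Context (H W M : nat) (v : R).
Let s (k : kernel R r) := speeding gamma H W M v k.
Let c := gamma^-1 ^+ 2 * (M.*2.+1)%:R ^+ 2 * (fast_prob E H v ^+ 2 + err H).

Lemma polynomial_speeding n : polynomial everywhere (fun k => s k n).
Proof.
apply: polynomialZ; apply: polynomial_sum => i.
exact: polynomial_ahead_everywhere.
Qed.

Lemma polynomial_slab_sum m n :
  polynomial everywhere (fun k => slab_sum (s k) H m n).
Proof.
elim: m n => [|m IH] n /=; first exact: polynomial_cst.
by apply: polynomialD => //; exact: polynomial_speeding.
Qed.

Lemma polynomial_slab_pair_sum m n :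
  polynomial everywhere (fun k => slab_pair_sum (s k) H m n).
Proof.
elim: m n => [|m IH] n /=; first exact: polynomial_cst.
apply: polynomialD => //; apply: polynomialM; first exact: polynomial_speeding.
exact: polynomial_slab_sum.
Qed.

Lemma expect_speeding2 n n' : (l < H)%N -> (n + 2 * H <= n')%N ->
  E (fun k => s k n * s k n') <= c.
Proof.
move=> lH nn'.
pose a (i : 'I_(M.*2.+1)) n0 (k : kernel R r) := ahead k H n0 (window_end W i)
  ((window_end W i)%:~R + v * H%:R).
have ap (i : 'I_(M.*2.+1)) n0 : polynomial everywhere (a i n0).
  exact: polynomial_ahead_everywhere.
have -> : (fun k => s k n * s k n') =
    (fun k => gamma^-1 ^+ 2 * \sum_i \sum_j a i n k * a j n' k).
  apply/funext => k; rewrite /s /speeding mulrACA -expr2 big_distrlr /=.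
  by [].
rewrite (expectZ EP); last first.
  by do 2![apply: polynomial_sum => ?]; exact: polynomialM.
rewrite /c -mulrA ler_wpM2l ?sqr_ge0 // expect_sum; last first.
  by move=> i; apply: polynomial_sum => ?; exact: polynomialM.
under eq_bigr => i _.
  rewrite expect_sum; last by move=> j; exact: polynomialM.
  over.
rewrite (_ : _ * _ = \sum_(i < M.*2.+1) \sum_(j < M.*2.+1)
    (fast_prob E H v ^+ 2 + err H)); last first.
  by rewrite !sumr_const !card_ord -!mulrnA expr2 -natrM mulr_natl.
apply: ler_sum => i _; apply: ler_sum => j _.
have <- : E (a i n) * E (a j n') = fast_prob E H v ^+ 2.
  by rewrite /a !(expect_ahead _ _ _ _ EP) expr2.
apply: (expect_mix EP (a := window_end W i - (r * H)%:Z)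
  (a' := window_end W j - (r * H)%:Z) lH nn').
- apply: polynomial_sub (polynomial_ahead _ _ _ _ _) => m x [h1 h2]; split; lia.
- apply: polynomial_sub (polynomial_ahead _ _ _ _ _) => m x [h1 h2]; split; lia.
- by move=> k kP; exact: (ahead_01 gamma_gt0 kP).
- by move=> k kP; exact: (ahead_01 gamma_gt0 kP).
Qed.

Lemma expect_slab_pair_sum m n : (l < H)%N ->
  E (fun k => slab_pair_sum (s k) H m n) <= m%:R ^+ 2 * c.
Proof.
move=> lH; have c0 : 0 <= c.
  by apply: mulr_ge0; [rewrite mulr_ge0 ?sqr_ge0|rewrite addr_ge0 ?sqr_ge0].
have one m' n' n0 : (n0 + 2 * H <= n')%N ->
    E (fun k => s k n0 * slab_sum (s k) H m' n') <= m'%:R * c.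
  elim: m' n' => [|m' IH] n' nn' /=.
    by under eq_fun do rewrite mulr0; rewrite (expect_cst EP) mul0r.
  under eq_fun do rewrite mulrDr.
  rewrite (expectD EP); last 2 first.
  - by apply: polynomialM; exact: polynomial_speeding.
  - by apply: polynomialM;
      [exact: polynomial_speeding|exact: polynomial_slab_sum].
  rewrite -natr1 mulrDl mul1r addrC; apply: lerD; last exact: expect_speeding2.
  by apply: IH; lia.
elim: m n => [|m IH] n /=; first by rewrite (expect_cst EP) expr0n mul0r.
rewrite (expectD EP); last 2 first.
- by apply: polynomialM;
    [exact: polynomial_speeding|exact: polynomial_slab_sum].
- exact: polynomial_slab_pair_sum.
apply: (@le_trans _ _ (m%:R * c + m%:R ^+ 2 * c)).
  apply: lerD => //; apply: (@le_trans _ _ (m.-1%:R * c)).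
    by apply: one; lia.
  by rewrite ler_wpM2r // ler_nat leq_pred.
rewrite -mulrDl ler_wpM2r // -natr1; have : 0 <= m%:R :> R by [].
by rewrite sqrrD; lra.
Qed.

End Slabs.

(** The renormalization inequality.  To be faster than [v] by [O(1/q)] over
    [q] slabs of height [H], the walk must be faster than [v] in two
    non-adjacent slabs; these events are almost independent, and the starting
    point in each slab ranges over [O(q ^ 2)] windows of width [H / q]. *)
Lemma fast_prob_recursion (H T q : nat) (v : R) :
  (0 < r)%N -> (l < H)%N -> (0 < q <= H)%N -> (q * H <= T < q.+1 * H)%N ->
  - r%:R <= v ->
  fast_prob E T (v + (6 * r + 2)%:R / q%:R) <=
  81 * r%:R ^+ 2 / gamma ^+ 2 * q%:R ^+ 6 * (fast_prob E H v ^+ 2 + err H).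
Proof.
move=> r0 lH /andP[q0 qH] /andP[qT Tq] vr.
(* a window costs a loss of speed [W / H <= 1 / q]; the walk stays in the range
   covered by [M] windows because [H <= 2 * q * W] *)
pose W := (H %/ q)%N; pose M := (4 * r * q ^ 2)%N.
have W0 : (0 < W)%N by rewrite divn_gt0.
have WH : (W * q <= H)%N by exact: leq_trunc_div.
have HW : (H <= 2 * q * W)%N.
  have h := ltn_ceil H q0; rewrite -/W mulSn in h.
  have h' : (q <= W * q)%N by rewrite leq_pmull.
  by lia.
have TM : (r * T <= M * W)%N.
  have h1 : (q.+1 * H <= 2 * q * H)%N by rewrite leq_mul2r mul2n -addnn; lia.
  have h2 : (2 * q * H <= 2 * q * (2 * q * W))%N by rewrite leq_mul2l HW orbT.
  have h3 : (T <= 2 * q * (2 * q * W))%N by lia.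
  rewrite (@leq_trans (r * (2 * q * (2 * q * W)))) ?leq_mul2l ?h3 ?orbT //.
  by rewrite /M; lia.
pose rho := (T - q * H)%N.
have Trho : (T = q * H + rho)%N by rewrite /rho; lia.
have rhoH : (rho < H)%N by rewrite /rho; lia.
have qr0 : 0 < q%:R :> R by rewrite ltr0n.
have Wq : W%:R <= q%:R^-1 * H%:R :> R.
  by rewrite mulrC ler_pdivlMr // -natrM ler_nat.
set B := (v + (6 * r + 2)%:R / q%:R) * T%:R.
pose u := v * H%:R + q%:R^-1 * H%:R.
have rv : 0 <= v + r%:R by lra.
have Hr0 : 0 < H%:R :> R by rewrite ltr0n; lia.
have qinv : q%:R * q%:R^-1 = 1 :> R by rewrite divff // gt_eqF.
have uge : - (r * H)%:R <= u.
  have h : 0 <= (v + r%:R) * H%:R by rewrite mulr_ge0.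
  have h' : 0 <= q%:R^-1 * H%:R :> R by rewrite mulr_ge0 ?invr_ge0 ?ltW.
  by rewrite natrM /u; lra.
have Bge : q%:R * u + 4 * (r * H)%:R + (r * rho)%:R < B.
  have rho_lt : rho%:R < H%:R :> R by rewrite ltr_nat.
  have -> : q%:R * u = q%:R * (v * H%:R) + H%:R.
    by rewrite /u mulrDr [_ * (_^-1 * _)]mulrA qinv mul1r.
  have -> : B = q%:R * (v * H%:R) + v * rho%:R + (6 * r + 2)%:R * H%:R
      + (6 * r + 2)%:R / q%:R * rho%:R.
    rewrite /B Trho; set K := (6 * r + 2)%:R; rewrite natrD natrM; field.
    exact: lt0r_neq0.
  have h1 : 0 <= (v + r%:R) * rho%:R by rewrite mulr_ge0.
  have h2 : 0 <= (6 * r + 2)%:R / q%:R * rho%:R :> R.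
    by rewrite !mulr_ge0 ?invr_ge0 // ltW.
  have h3 : r%:R * rho%:R <= r%:R * H%:R :> R by rewrite ler_wpM2l // ltW.
  rewrite natrD !natrM; have := mulr_ge0 (ler0n R r) (ltW Hr0); lra.
have main (k : kernel R r) : elliptic gamma k ->
    ahead k T 0 0 B <= slab_pair_sum (speeding gamma H W M v k) H q 0.
  move=> kP; rewrite {1}Trho.
  apply: (@ahead_le_slab_pair_sum R r gamma gamma_gt0 k kP _ _ H T rho u) => //.
  - by move=> n; exact: speeding_ge0.
  - move=> n x xn nT; apply: ahead_le_speeding => //.
      have h : (r * n <= r * T)%N by rewrite leq_mul2l; lia.
      by lia.
    by rewrite /u; lra.
  - by lia.
  - by rewrite mulr0z; lra.
apply: (@le_trans _ _
  (E (fun k => slab_pair_sum (speeding gamma H W M v k) H q 0))).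
  apply: (expect_le EP) => //.
    exact: polynomial_ahead_everywhere.
  exact: polynomial_slab_pair_sum.
apply: le_trans (expect_slab_pair_sum W M v q 0 lH) _.
rewrite [q%:R ^+ 2 * _]mulrA ler_wpM2r ?addr_ge0 ?sqr_ge0 //.
have -> : 81 * r%:R ^+ 2 / gamma ^+ 2 * q%:R ^+ 6 =
    (q%:R ^+ 2 * gamma^-1 ^+ 2) * (9 * r * q ^ 2)%:R ^+ 2.
  by rewrite !natrM exprVn; ring.
rewrite [leLHS]mulrA ler_wpM2l ?mulr_ge0 ?sqr_ge0 ?invr_ge0 ?(ltW gamma_gt0) //.
rewrite lerXn2r ?nnegrE // ler_nat /M.
have : (0 < r * q ^ 2)%N by rewrite muln_gt0 r0 expn_gt0 q0.
by rewrite -!muln2; lia.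
Qed.

End Recursion.

(** * Scales *)

(** Ratio between the scale of level [m] and the scale of level 0; the number
    of blocks merged at level [m] is [L * 2 ^ m].  The growth of this number
    makes the losses of speed at successive levels summable. *)
Fixpoint zoom (L m : nat) : nat :=
  if m is m'.+1 then (L * 2 ^ m' * zoom L m')%N else 1%N.

Lemma zoom_gt0 L m : (0 < L)%N -> (0 < zoom L m)%N.
Proof. by move=> L0; elim: m => //= m IH; rewrite !muln_gt0 L0 expn_gt0 IH. Qed.

Lemma zoom_ge2 L m : (16 <= L)%N -> ((2 ^ m) ^ 2 <= zoom L m)%N.
Proof.
move=> L16; elim: m => //= m IH; rewrite [(2 ^ m.+1)%N]expnS expnMn.
apply: leq_mul => //.
have : (0 < 2 ^ m)%N by rewrite expn_gt0.
by nia.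
Qed.

Section Decay.
Context (R : realType) (theta : R) (theta_ge2 : 2 <= theta).

(** With [theta = alpha / 4], the mixing error at scale [H] is
    [c0 / npow H ^+ 4] and the announced decay is [c / npow n]. *)
Definition npow (n : nat) : R := n%:R `^ theta.

Lemma npowM m n : npow (m * n) = npow m * npow n.
Proof. by rewrite /npow natrM powRM. Qed.

Lemma npow_gt0 n : (0 < n)%N -> 0 < npow n.
Proof. by move=> n0; rewrite powR_gt0 // ltr0n. Qed.

Lemma npow_le m n : (m <= n)%N -> npow m <= npow n.
Proof.
move=> mn; apply: ge0_ler_powR; rewrite ?nnegrE ?ler_nat //.
exact: le_trans theta_ge2.
Qed.

Lemma npow1 : npow 1 = 1. Proof. by rewrite /npow powR1. Qed.

Lemma npow2_ge : 4 <= npow 2.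
Proof.
have -> : 4 = 2%:R `^ 2%:R :> R by rewrite powR_mulrn // -natrX.
by apply: ler_powR; rewrite ?ler1n.
Qed.

Lemma npow16 : npow 16 = npow 2 ^+ 4.
Proof. by rewrite -[16%N]/(2 * (2 * (2 * 2)))%N !npowM; ring. Qed.

(** From one level to the next, the numerator is multiplied by
    [2 ^+ a * npow 2 ^+ 2] and the denominator by at least [npow 16 ^+ b]. *)
Lemma zoom_beats_power (a b : nat) L m : (16 <= L)%N ->
  2 ^+ a * npow 2 ^+ 2 <= npow 16 ^+ b ->
  (L * 2 ^ m)%:R ^+ a * npow (L * 2 ^ m) ^+ 2 / npow (zoom L m) ^+ b
  <= L%:R ^+ a * npow L ^+ 2.
Proof.
move=> L16 ab; elim: m => [|m IH] /=.
  by rewrite npow1 expr1n divr1 muln1.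
apply: le_trans IH.
set K := (L * 2 ^ m)%N.
have K16 : (16 <= K)%N.
  by rewrite (leq_trans L16) // leq_pmulr // expn_gt0.
have K0 : 0 < npow K by rewrite npow_gt0 //; lia.
have Z0 : 0 < npow (zoom L m) by rewrite npow_gt0 // zoom_gt0 //; lia.
have -> : (L * 2 ^ m.+1 = 2 * K)%N by rewrite /K expnS mulnCA.
rewrite (npowM 2 K) (npowM K) (natrM R 2 K).
have -> : (2 * K%:R) ^+ a * (npow 2 * npow K) ^+ 2 /
    (npow K * npow (zoom L m)) ^+ b =
    (2 ^+ a * npow 2 ^+ 2 / npow K ^+ b) *
    (K%:R ^+ a * npow K ^+ 2 / npow (zoom L m) ^+ b) :> R.
  by rewrite !exprMn invfM; ring.
rewrite -[leRHS]mul1r ler_wpM2r //.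
  by rewrite !mulr_ge0 ?invr_ge0 ?exprn_ge0 // ltW.
rewrite ler_pdivrMr ?exprn_gt0 // mul1r (le_trans ab) //.
by rewrite lerXn2r ?nnegrE ?npow_le ?ltW // npow_gt0.
Qed.

Lemma npow16_pow2 : 2 ^+ 6 * npow 2 ^+ 2 <= npow 16 ^+ 2.
Proof.
rewrite npow16; have := npow2_ge; move: (npow 2) => t t4.
have t2 : 16 <= t ^+ 2 by rewrite (_ : 16 = 4 ^+ 2) ?lerXn2r ?nnegrE //; [lra|ring].
have -> : (t ^+ 4) ^+ 2 = t ^+ 2 * t ^+ 2 * t ^+ 2 * t ^+ 2 by ring.
have h : 0 <= t ^+ 2 by rewrite sqr_ge0.
rewrite ler_wpM2r //.
have -> : 2 ^+ 6 = 4 * 4 * 4 :> R by ring.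
by rewrite !ler_pM ?mulr_ge0 //; lra.
Qed.

Lemma npow16_pow3 : 2 ^+ 12 * npow 2 ^+ 2 <= npow 16 ^+ 3.
Proof.
rewrite npow16; have := npow2_ge; move: (npow 2) => t t4.
have t10 : 4 ^+ 10 <= t ^+ 10 by rewrite lerXn2r ?nnegrE //; lra.
have -> : (t ^+ 4) ^+ 3 = t ^+ 10 * t ^+ 2 by ring.
rewrite ler_wpM2r ?sqr_ge0 // (le_trans _ t10) //.
by rewrite -!natrX ler_nat.
Qed.

End Decay.

(** * Polynomial decay from one small probability *)

Section Trigger.
Context (R : realType) (theta : R) (theta_ge2 : 2 <= theta).
Context (r : nat) (gamma c0 : R) (l : nat) (E : (kernel R r -> R) -> R).
Context (r_gt0 : (0 < r)%N) (gamma_gt0 : 0 < gamma) (c0_ge0 : 0 <= c0).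
Let pow := npow theta.
Let err (H : nat) : R := c0 / pow H ^+ 4.
Context (EP : kernel_expectation gamma l err E).

Let C1 : R := (6 * r + 2)%:R.
Let C2 : R := 81 * r%:R ^+ 2 / gamma ^+ 2.

(** Smallness of [fast_prob] from which the renormalization propagates when it
    starts with [L] slabs at the first level. *)
Definition trigger_level (L : nat) : R := (2 * C2 * (L%:R ^+ 6 * pow L ^+ 2))^-1.

Let C2_gt0 : 0 < C2.
Proof. by rewrite !mulr_gt0 ?invr_gt0 ?exprn_gt0 ?ltr0n. Qed.

Let err_ge0 H : 0 <= err H.
Proof. by rewrite mulr_ge0 // invr_ge0 exprn_ge0 // powR_ge0. Qed.

Lemma trigger_level_gt0 L : (0 < L)%N -> 0 < trigger_level L.
Proof.
move=> L0; rewrite invr_gt0; apply: mulr_gt0; first exact: mulr_gt0.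
by rewrite mulr_gt0 // exprn_gt0 ?ltr0n // npow_gt0.
Qed.

Section Scales.
Context (L H0 : nat) (v : R).
Context (L_ge16 : (16 <= L)%N) (v_ge : - r%:R <= v) (lH0 : (l < H0)%N).
Context (H0_ge : (2 * L ^ 2 <= H0)%N).
Let a := trigger_level L.
Context (err_le : err H0 <= a ^+ 2) (p_le : fast_prob E H0 v <= a).

Let speed m := v + 2 * C1 / L%:R * (1 - (2 ^ m)%:R^-1).

Let L_gt0 : (0 < L)%N. Proof. lia. Qed.

Let C1_ge0 : 0 <= C1. Proof. by []. Qed.

Let speedS m : speed m.+1 = speed m + C1 / (L * 2 ^ m)%:R.
Proof.
rewrite /speed expnS !natrM; field.
by apply/andP; split; rewrite pnatr_eq0 -lt0n ?expn_gt0.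
Qed.

Let speed_ge m : v <= speed m.
Proof.
rewrite lerDl !mulr_ge0 ?invr_ge0 // subr_ge0 invf_le1 ?ltr0n ?expn_gt0 //.
by rewrite ler1n expn_gt0.
Qed.

Let speed_le m : speed m <= v + 2 * C1 / L%:R.
Proof.
rewrite lerD2l -[leRHS]mulr1 ler_wpM2l ?mulr_ge0 ?invr_ge0 //.
Qed.

Let scale_ge m : (2 * (L * 2 ^ m) ^ 2 <= zoom L m * H0)%N.
Proof.
rewrite expnMn mulnA mulnC; apply: leq_mul => //.
exact: zoom_ge2.
Qed.

Let scale_err m : err (zoom L m * H0) <= a ^+ 2 / pow (zoom L m) ^+ 4.
Proof.
rewrite /err /pow npowM // exprMn invfM mulrCA mulrC ler_wpM2r //.
by rewrite invr_ge0 exprn_ge0 // powR_ge0.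
Qed.

(** The bound is squared at each level, up to a factor [K ^ 6] with
    [K = L * 2 ^ m] and a mixing error of the same order; [zoom_beats_power] shows
    that the square compensates both this factor and the increase of scale. *)
Lemma fast_prob_scale m :
  fast_prob E (zoom L m * H0) (speed m) <= a / pow (zoom L m) ^+ 2.
Proof.
elim: m => [|m IH].
  by rewrite /speed /= mul1n /pow npow1 // expr1n divr1 invr1 subrr mulr0 addr0.
set K := (L * 2 ^ m)%N.
have K_gt0 : (0 < K)%N by rewrite muln_gt0 L_gt0 expn_gt0.
have Z_gt0 : (0 < zoom L m)%N by rewrite zoom_gt0.
rewrite speedS /= -/K -mulnA.
have KH : (K <= zoom L m * H0)%N.
  apply: leq_trans (scale_ge m); rewrite -/K -mulnn; nia.
have lH : (l < zoom L m * H0)%N.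
  by apply: (leq_trans lH0); rewrite leq_pmull.
apply: le_trans
  (fast_prob_recursion gamma_gt0 err_ge0 EP (T := K * (zoom L m * H0)) (q := K)
     r_gt0 lH _ _ (le_trans v_ge (speed_ge m))) _.
- by rewrite K_gt0.
- by rewrite leqnn ltn_pmul2r ?ltnSn //; lia.
rewrite -/C2.
have pk0 : 0 < pow K by exact: npow_gt0.
have pz0 : 0 < pow (zoom L m) by exact: npow_gt0.
have aD : a * (2 * C2 * (L%:R ^+ 6 * pow L ^+ 2)) = 1.
  by rewrite mulVf // gt_eqF // -invr_gt0 trigger_level_gt0.
have a0 : 0 < a by exact: trigger_level_gt0.
apply: (@le_trans _ _ (C2 * K%:R ^+ 6 * (2 * a ^+ 2 / pow (zoom L m) ^+ 4))).
  apply: ler_wpM2l; first by rewrite mulr_ge0 ?exprn_ge0 // ltW.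
  have -> : 2 * a ^+ 2 / pow (zoom L m) ^+ 4 =
      (a / pow (zoom L m) ^+ 2) ^+ 2 + a ^+ 2 / pow (zoom L m) ^+ 4.
    by field; rewrite gt_eqF.
  apply: lerD => //; rewrite lerXn2r ?nnegrE //.
    by have /andP[] := fast_prob_01 gamma_gt0 EP (zoom L m * H0) (speed m).
  by apply: divr_ge0; [exact: ltW|apply: exprn_ge0; exact: ltW].
have F := zoom_beats_power theta_ge2 m L_ge16 (npow16_pow2 theta_ge2).
rewrite -/K -/pow in F.
rewrite /pow npowM -/pow //.
have -> : C2 * K%:R ^+ 6 * (2 * a ^+ 2 / pow (zoom L m) ^+ 4) =
   (a / (pow K ^+ 2 * pow (zoom L m) ^+ 2)) * (a * (2 * C2 *
     (K%:R ^+ 6 * pow K ^+ 2 / pow (zoom L m) ^+ 2))).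
  by field; rewrite !gt_eqF.
rewrite exprMn -[leRHS]mulr1; apply: ler_wpM2l.
  apply: divr_ge0; first exact: ltW.
  by apply: mulr_ge0; apply: exprn_ge0; exact: ltW.
rewrite -[leRHS]aD; apply: ler_wpM2l; first exact: ltW.
by apply: ler_wpM2l => //; rewrite mulr_ge0 // ltW.
Qed.

Lemma zoom_unbounded n : (zoom L 1 * H0 <= n)%N ->
  exists m, (zoom L m.+1 * H0 <= n < zoom L m.+2 * H0)%N.
Proof.
move=> n1; have Hex : exists m, (n < zoom L m * H0)%N.
  exists n; apply: (@leq_trans (2 ^ n)); first exact: ltn_expl.
  apply: leq_trans (leq_pmulr _ _); last by lia.
  apply: leq_trans (zoom_ge2 n L_ge16); rewrite -mulnn leq_pmulr //.
  by rewrite expn_gt0.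
have [[|[|m]] Hm Hmin] := ex_minnP Hex.
- move: n1 Hm; rewrite /= expn0 !muln1 mul1n => n1 Hm.
  by have := leq_pmull H0 L_gt0; lia.
- by rewrite ltnNge n1 in Hm.
exists m; rewrite Hm andbT leqNgt; apply/negP => /Hmin.
by rewrite ltnn.
Qed.

(** A time [n] between two consecutive scales is compared with the scale below
    them by one more use of the renormalization inequality, with
    [q = n %/ (zoom L m * H0)]. *)
Lemma fast_prob_decay : exists2 c, 0 < c &
  forall n, (1 <= n)%N -> fast_prob E n (v + 2 * C1 / L%:R) <= c / pow n.
Proof.
have a0 : 0 < a by exact: trigger_level_gt0.
pose D := L%:R ^+ 12 * pow L ^+ 2.
have D0 : 0 < D by rewrite mulr_gt0 ?exprn_gt0 ?ltr0n // npow_gt0.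
pose c := 128 * C2 * a ^+ 2 * D * pow (2 * H0).
have H00 : (0 < H0)%N := leq_ltn_trans (leq0n l) lH0.
have c0' : 0 < c.
  apply: mulr_gt0; last by apply: npow_gt0; rewrite muln_gt0.
  apply: mulr_gt0 => //; apply: mulr_gt0; first exact: mulr_gt0.
  exact: exprn_gt0.
exists (c + pow (zoom L 1 * H0)).
  by apply: addr_gt0 => //; apply: npow_gt0; rewrite muln_gt0 zoom_gt0.
move=> n n1; have pn0 : 0 < pow n by rewrite npow_gt0.
rewrite ler_pdivlMr //.
have [/zoom_unbounded[m /andP[mn nm]]|nH] := leqP (zoom L 1 * H0) n; last first.
  apply: (@le_trans _ _ (pow n)).
    rewrite -[leRHS]mul1r ler_wpM2r ?(ltW pn0) //.
    by have /andP[] := fast_prob_01 gamma_gt0 EP n (v + 2 * C1 / L%:R).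
  apply: (@le_trans _ _ (pow (zoom L 1 * H0))); last by rewrite lerDr ltW.
  by apply: npow_le => //; exact: ltnW.
set K := (L * 2 ^ m)%N.
set H := (zoom L m * H0)%N.
have K_gt0 : (0 < K)%N by rewrite muln_gt0 L_gt0 expn_gt0.
have Z_gt0 : (0 < zoom L m)%N by rewrite zoom_gt0.
have H_gt0 : (0 < H)%N by rewrite muln_gt0 Z_gt0.
have mn' : (K * H <= n)%N by rewrite /H mulnA.
have nm' : (n < 2 * K ^ 2 * H)%N.
  rewrite (_ : 2 * K ^ 2 * H = zoom L m.+2 * H0)%N //.
  by rewrite -mulnn [zoom _ _]/= /H /K expnS; move: (2 ^ m)%N (zoom L m) => M Z; ring.
pose q := (n %/ H)%N.
have Kq : (K <= q)%N by rewrite leq_divRL.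
have qK : (q < 2 * K ^ 2)%N by rewrite ltn_divLR.
have qH : (q <= H)%N by apply: leq_trans (ltnW qK) _; exact: scale_ge.
have lH : (l < H)%N by apply: (leq_trans lH0); rewrite leq_pmull.
have pk0 : 0 < pow K by exact: npow_gt0.
have pz0 : 0 < pow (zoom L m) by exact: npow_gt0.
apply: (@le_trans _ _ (c / pow n * pow n)); last first.
  by rewrite divfK ?gt_eqF // lerDl powR_ge0.
rewrite ler_wpM2r ?(ltW pn0) //.
apply: (@le_trans _ _ (fast_prob E n (speed m + C1 / q%:R))).
  apply: (fast_prob_mono gamma_gt0 EP); apply: le_trans (speed_le m.+1).
  rewrite speedS lerD2l ler_wpM2l // lef_pV2 ?posrE ?ltr0n //.
    by rewrite ler_nat.
  exact: leq_trans Kq.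
apply: le_trans (fast_prob_recursion gamma_gt0 err_ge0 EP (T := n) (q := q)
     r_gt0 lH _ _ (le_trans v_ge (speed_ge m))) _.
- by rewrite qH andbT (leq_trans K_gt0).
- by rewrite leq_trunc_div ltn_ceil.
rewrite -/C2.
apply: (@le_trans _ _ (C2 * (2 * K ^ 2)%:R ^+ 6 *
    (2 * a ^+ 2 / pow (zoom L m) ^+ 4))).
  apply: ler_pM.
  - by rewrite mulr_ge0 ?exprn_ge0 // ltW.
  - by rewrite addr_ge0 ?sqr_ge0.
  - apply: ler_wpM2l; first exact: ltW.
    by rewrite lerXn2r ?nnegrE // ler_nat ltnW.
  have -> : 2 * a ^+ 2 / pow (zoom L m) ^+ 4 =
      (a / pow (zoom L m) ^+ 2) ^+ 2 + a ^+ 2 / pow (zoom L m) ^+ 4.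
    by field; rewrite gt_eqF.
  apply: lerD; last exact: scale_err.
  rewrite lerXn2r ?nnegrE //.
  - by have /andP[] := fast_prob_01 gamma_gt0 EP H (speed m).
  - by apply: divr_ge0; [exact: ltW|apply: exprn_ge0; exact: ltW].
  - exact: fast_prob_scale.
have F := zoom_beats_power theta_ge2 m L_ge16 (npow16_pow3 theta_ge2).
rewrite -/K -/pow -/D in F.
rewrite ler_pdivlMr //.
have pn : pow n <= pow (2 * H0) * pow K ^+ 2 * pow (zoom L m).
  have nm'' : (n <= 2 * H0 * (K * K) * zoom L m)%N.
    apply: leq_trans (ltnW nm') _; rewrite /H -mulnn leq_eqVlt.
    by apply/orP; left; apply/eqP; ring.
  rewrite expr2 /pow -!npowM; exact: npow_le.
apply: le_trans (ler_wpM2l _ pn) _.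
  apply: mulr_ge0; first by apply: mulr_ge0; [exact: ltW|exact: exprn_ge0].
  apply: divr_ge0; first by rewrite mulr_ge0 ?sqr_ge0.
  by apply: exprn_ge0; exact: ltW.
rewrite natrM natrX.
have -> : C2 * (2 * K%:R ^+ 2) ^+ 6 * (2 * a ^+ 2 / pow (zoom L m) ^+ 4) *
    (pow (2 * H0) * pow K ^+ 2 * pow (zoom L m)) =
    128 * C2 * a ^+ 2 * (K%:R ^+ 12 * pow K ^+ 2 / pow (zoom L m) ^+ 3) *
    pow (2 * H0).
  by field; rewrite gt_eqF.
rewrite /c; apply: ler_wpM2r; first exact: powR_ge0.
apply: ler_wpM2l => //.
by apply: mulr_ge0; [apply: mulr_ge0; [|exact: ltW]|exact: sqr_ge0].
Qed.

End Scales.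
End Trigger.

(** * Traps *)

Section Traps.
Context (R : realType) (r : nat) (gamma : R) (gamma_gt0 : 0 < gamma).
Context (H : nat) (h : int) (b w : R) (delay : nat).

(** A trap at [(y, n)] is nothing more than this probability: by
    [slow_quasi_mono] it is enough to consider the walk started at [y]. *)
Definition slow (k : kernel R r) (n : nat) (y : int) : R :=
  quenched k H n (fun z => (z%:~R <= y%:~R + b)%R%:R) y.

Definition overspeed (k : kernel R r) (n : nat) (y : int) : R :=
  gamma^-1 * ahead k H n y (y%:~R + w).

(** Traps are set along the line of slope [h / H] issued from [(y, n)], in the
    time slabs whose index has no digit 1 in base 3: any two groups of traps are
    then separated by as much time as they occupy, as decorrelation demands. *)
Fixpoint escape (m : nat) (k : kernel R r) (n : nat) (y : int) : R :=
  if m is m'.+1 then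
    escape m' k n y *
    escape m' k (n + 2 * (3 ^ m' * H)) (y + (2 * 3 ^ m')%:Z * h)
  else 1 - gamma * slow k n y.

Fixpoint overspeed_sum (m : nat) (k : kernel R r) (n : nat) (y : int) : R :=
  if m is m'.+1 then
    overspeed_sum m' k n y +
    overspeed_sum m' k (n + 3 ^ m' * H) (y + (3 ^ m')%:Z * h) +
    overspeed_sum m' k (n + 2 * (3 ^ m' * H)) (y + (2 * 3 ^ m')%:Z * h)
  else overspeed k n y + overspeed k n (y - delay%:Z).

Section Quenched.
Context (k : kernel R r) (kP : elliptic gamma k).

Lemma slow_01 n y : 0 <= slow k n y <= 1.
Proof. by apply: (quenched_01 gamma_gt0 kP) => z; exact: indic_01. Qed.

Lemma escape_01 m n y : 0 <= escape m k n y <= 1.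
Proof.
elim: m n y => [|m IH] n y /=.
  have /andP[s0 s1] := slow_01 n y; have g1 := gamma_le1 gamma_gt0 kP.
  have gs : 0 <= gamma * slow k n y by rewrite mulr_ge0 // ltW.
  have : gamma * slow k n y <= 1 by rewrite -[leRHS]mulr1 ler_pM // ltW.
  by lra.
have /andP[a0 a1] := IH n y.
have /andP[c0 c1] :=
  IH (n + 2 * (3 ^ m * H))%N (y + (2 * 3 ^ m)%:Z * h).
by rewrite mulr_ge0 //= -[leRHS]mulr1 ler_pM.
Qed.

Lemma overspeed_ge0 n y : 0 <= overspeed k n y.
Proof.
rewrite mulr_ge0 ?invr_ge0 ?(ltW gamma_gt0) //.
by have /andP[] := ahead_01 gamma_gt0 kP H n y (y%:~R + w).
Qed.

Lemma overspeed_sum_ge0 m n y : 0 <= overspeed_sum m k n y.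
Proof.
by elim: m n y => [|m IH] n y /=; rewrite !addr_ge0 // overspeed_ge0.
Qed.

(** Any walk that starts behind [y] is trapped with a comparable probability. *)
Lemma slow_quasi_mono n x y : x <= y ->
  gamma * slow k n y <= quenched k H n (fun z => (z%:~R <= y%:~R + b)%R%:R) x.
Proof.
apply: (quenched_quasi_nonincreasing gamma_gt0 kP) => //.
move=> z z' zz'; rewrite ler_nat; case: (lerP z%:~R _) => // zb.
by rewrite (le_trans _ zb) // ler_int.
Qed.

Lemma ahead_le_overspeed n x y : x <= y ->
  ahead k H n x (y%:~R + w) <= overspeed k n y.
Proof. by move=> xy; exact: (ahead_quasi_mono gamma_gt0 kP). Qed.

Context (w_le : w <= h%:~R) (b_le : b <= h%:~R - delay%:R).

(** A walk below the line has been caught by no trap with conditional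
    probability at most [escape]; once caught it stays below the delayed line.
    Both statements fail only if the walk is too fast in some slab. *)
Lemma quenched_le_escape m n y (phi : int -> R) A D :
  0 <= A -> 0 <= D -> (forall z, phi z <= 1) ->
  (forall z, z <= y + (3 ^ m)%:Z * h -> phi z <= D + A) ->
  (forall z, z <= y + (3 ^ m)%:Z * h - delay%:Z -> phi z <= D) ->
  (forall x, x <= y - delay%:Z ->
     quenched k (3 ^ m * H) n phi x <= D + overspeed_sum m k n y) /\
  (forall x, x <= y ->
     quenched k (3 ^ m * H) n phi x <=
     D + escape m k n y * A + overspeed_sum m k n y).
Proof.
elim: m n y phi A D => [|m IH] n y phi A D A0 D0 phi1 phiA phiD.
  rewrite expn0 mul1r mul1n in phiA phiD *; split=> x xy /=.
    apply: (@le_trans _ _ (quenched k H n (fun z =>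
        D + ((y - delay%:Z)%:~R + w <= z%:~R)%R%:R) x)).
      apply: (quenched_le gamma_gt0 kP) => z _.
      have [zy|zy] := lerP z (y + h - delay%:Z).
        by apply: (le_trans (phiD _ zy)); rewrite lerDl.
      have zy' : (y - delay%:Z)%:~R + w <= z%:~R.
        apply: (@le_trans _ _ ((y - delay%:Z)%:~R + h%:~R)).
          by rewrite lerD2l.
        by rewrite -rmorphD /= ler_int; lia.
      by rewrite zy'; apply: (le_trans (phi1 z)); rewrite lerDr.
    rewrite quenchedD (quenched_cst kP) lerD2l.
    apply: le_trans (ahead_le_overspeed n xy) _.
    by rewrite lerDr overspeed_ge0.
  apply: (@le_trans _ _ (quenched k H n (fun z =>
      ((D + A) + (- A) * (z%:~R <= y%:~R + b)%R%:R) +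
        (y%:~R + w <= z%:~R)%R%:R) x)).
    apply: (quenched_le gamma_gt0 kP) => z _.
    case: (lerP z%:~R (y%:~R + b)) => [zb|zb].
      have zy : z <= y + h - delay%:Z.
        rewrite -(ler_int R); apply: (le_trans zb).
        by rewrite rmorphB rmorphD /= -addrA lerD2l.
      by apply: (le_trans (phiD _ zy)); rewrite mulr1 addrK lerDl.
    rewrite mulr0 addr0; have [zy|zy] := lerP z (y + h).
      by apply: (le_trans (phiA _ zy)); rewrite lerDl.
    have -> : y%:~R + w <= z%:~R.
      apply: (@le_trans _ _ (y%:~R + h%:~R)); first by rewrite lerD2l.
      by rewrite -rmorphD /= ler_int ltW.
    by apply: (le_trans (phi1 z)); rewrite lerDr addr_ge0.
  rewrite !quenchedD !(quenched_cst kP) quenchedZ.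
  have h1 := ahead_le_overspeed n xy; rewrite /ahead in h1.
  have h2 := overspeed_ge0 n (y - delay%:Z).
  have h3 := ler_wpM2l A0 (slow_quasi_mono n xy).
  by lra.
set N := (3 ^ m * H)%N.
have -> : (3 ^ m.+1 * H = N + (N + N))%N by rewrite /N expnS; lia.
(* the three thirds of the block are treated backwards in time; the traps of
   the middle third are ignored *)
have e3 : (3 ^ m.+1)%:Z * h = (2 * 3 ^ m)%:Z * h + (3 ^ m)%:Z * h.
  by rewrite -mulrDl -PoszD; congr (_%:Z * _); rewrite expnS; lia.
rewrite e3 addrA in phiA phiD.
have q1 N' n' (f : int -> R) : (forall z, f z <= 1) ->
    forall z, quenched k N' n' f z <= 1.
  move=> f1 z; rewrite -[leRHS](quenched_cst kP N' n' 1 z).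
  by apply: (quenched_le gamma_gt0 kP).
have [third_delayed third] := IH (n + 2 * N)%N _ _ _ _ A0 D0 phi1 phiA phiD.
set phi2 := quenched k N (n + 2 * N) phi in third_delayed third.
set y2 := y + (2 * 3 ^ m)%:Z * h in third_delayed third.
set P2 := escape m k (n + 2 * N) y2 in third.
set O2 := overspeed_sum m k (n + 2 * N) y2 in third_delayed third.
have O2_ge0 : 0 <= O2 by exact: overspeed_sum_ge0.
have /andP[P2_ge0 P2_le1] : 0 <= P2 <= 1 by exact: escape_01.
set y1 := y + (3 ^ m)%:Z * h.
have y2E : y2 = y1 + (3 ^ m)%:Z * h.
  by rewrite /y1 /y2 -addrA -mulrDl -PoszD; congr (_ + _%:Z * _); lia.
have nE : (n + 2 * N = n + N + N)%N by lia.
set P1 := escape m k (n + N) y1; set O1 := overspeed_sum m k (n + N) y1.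
have /andP[P1_ge0 P1_le1] : 0 <= P1 <= 1 by exact: escape_01.
have O1_ge0 : 0 <= O1 by exact: overspeed_sum_ge0.
have PA_ge0 : 0 <= P2 * A by rewrite mulr_ge0.
have [second_delayed second] : _ /\ _ :=
  IH (n + N)%N y1 phi2 (P2 * A) (D + O2) PA_ge0 (addr_ge0 D0 O2_ge0)
    (q1 _ _ _ phi1)
    (fun z zy => ltac:(by rewrite -y2E in zy; have := third z zy; lra))
    (fun z zy => ltac:(by rewrite -y2E in zy; exact: third_delayed)).
rewrite -/P1 -/O1 in second_delayed second.
set phi1' := quenched k N (n + N) phi2 in second_delayed second.
have [first_delayed first] : _ /\ _ :=
  IH n y phi1' (P2 * A) (D + O2 + O1) PA_ge0
    (addr_ge0 (addr_ge0 D0 O2_ge0) O1_ge0)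
    (q1 _ _ _ (q1 _ _ _ phi1))
    (fun z zy => ltac:(
       have := second z zy;
       have := ler_wpM2r PA_ge0 P1_le1; lra))
    second_delayed.
have qE x : quenched k (N + (N + N)) n phi x = quenched k N n phi1' x.
  rewrite quenched_add; congr (quenched k N n _ x); apply/funext => z.
  by rewrite quenched_add /phi1' /phi2 nE.
split=> x xy; rewrite qE /= -/N -/y1 -/y2 -/P2 -/O1 -/O2.
  by have := first_delayed x xy; lra.
by have := first x xy; rewrite mulrA; lra.
Qed.

Lemma ahead_le_escape m B : ((3 ^ m)%:Z * h - delay%:Z)%:~R < B ->
  ahead k (3 ^ m * H) 0 0 B <= escape m k 0 0 + overspeed_sum m k 0 0.
Proof.
move=> hB.
have phi_le1 (z : int) : (B <= z%:~R)%R%:R <= 1 :> R.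
  by have /andP[] := indic_01 R (B <= z%:~R).
have phi_le (z : int) : z <= 0 + (3 ^ m)%:Z * h ->
    (B <= z%:~R)%R%:R <= 0 + 1 :> R.
  by move=> _; rewrite add0r.
have phi_delay (z : int) : z <= 0 + (3 ^ m)%:Z * h - delay%:Z ->
    (B <= z%:~R)%R%:R <= 0 :> R.
  rewrite add0r => zy; rewrite lern0 eqb0 -ltNge; apply: le_lt_trans hB.
  by rewrite ler_int.
have [_ /(_ 0 (lexx _))] :=
  @quenched_le_escape m 0 0 _ 1 0 ler01 (lexx _) phi_le1 phi_le phi_delay.
by rewrite add0r mulr1.
Qed.

End Quenched.
End Traps.

(** * Expectations of trap functionals *)

Section TrapExpectation.
Context (R : realType) (r : nat) (gamma : R) (l : nat) (err : nat -> R).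
Context (E : (kernel R r -> R) -> R).
Context (gamma_gt0 : 0 < gamma).
Context (EP : kernel_expectation gamma l err E).

Section Fixed.
Context (H : nat) (h : int) (b u : R) (delay : nat).
Let esc := @escape R r gamma H h b.
Let over := @overspeed R r gamma H (u * H%:R).
Let over_sum := @overspeed_sum R r gamma H h (u * H%:R) delay.

Lemma slow_shift x0 t0 (k : kernel R r) n y :
  slow H b (shift_kernel x0 t0 k) n y = slow H b k (t0 + n) (x0 + y).
Proof.
rewrite /slow quenched_shift; congr quenched; apply/funext => z.
by congr (nat_of_bool _)%:R; rewrite rmorphB rmorphD /= lerBlDl addrA.
Qed.

Lemma escape_shift m x0 t0 (k : kernel R r) n y :
  esc m (shift_kernel x0 t0 k) n y = esc m k (t0 + n) (x0 + y).
Proof.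
rewrite /esc; elim: m n y => [|m IH] n y /=; first by rewrite slow_shift.
by rewrite !IH addnA addrA.
Qed.

Lemma polynomial_escape m n y :
  polynomial (in_box (y - (r * H + (3 ^ m - 1) * `|h|%N)%:Z)
                     (y + (r * H + (3 ^ m - 1) * `|h|%N)%:Z)
                     n (n + 3 ^ m * H)) (fun k => esc m k n y).
Proof.
rewrite /esc; elim: m n y => [|m IH] n y /=.
  apply: polynomialBC; apply: polynomialZ.
  apply: polynomial_sub (polynomial_quenched _ _ _ _ _) => t x [h1 h2].
  by split; lia.
have N0 : (0 < 3 ^ m)%N by rewrite expn_gt0.
rewrite expnS; move: (3 ^ m)%N N0 IH => N N0 IH.
have hN : (N <= 3 * N)%N by lia.
have e : ((3 * N - 1) * `|h| = (N - 1) * `|h| + 2 * (N * `|h|))%N by nia.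
apply: polynomialM.
  apply: polynomial_sub (IH n y) => t x [h1 h2].
  by rewrite e; split; lia.
apply: polynomial_sub (IH _ _) => t x [h1 h2].
rewrite e; split; last by lia.
have hh : - (2 * (N * `|h|))%N%:Z <= (2 * N)%N%:Z * h <= (2 * (N * `|h|))%N%:Z.
  by case: h {e IH h1} => a; nia.
by lia.
Qed.

Lemma polynomial_escape_everywhere m n y :
  polynomial everywhere (fun k => esc m k n y).
Proof. exact: polynomial_everywhere (polynomial_escape m n y). Qed.

Lemma expect_escape m n y :
  E (fun k => esc m k n y) = E (fun k => esc m k 0 0).
Proof.
rewrite -(expect_shift EP y n (f := fun k => esc m k 0 0)).
  by congr E; apply/funext => k; rewrite escape_shift addn0 addr0.
exact: polynomial_escape_everywhere.
Qed.

(** The two groups of traps occupy times of length [3 ^ m * H] and are separated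
    by as much, so they decorrelate. *)
Lemma expect_escape_rec m : (l < 3 ^ m * H)%N ->
  (2 * `|h| <= (2 * r + 1) * H)%N ->
  E (fun k => esc m.+1 k 0 0) <=
  E (fun k => esc m k 0 0) ^+ 2 + err (3 ^ m * H).
Proof.
move=> lH hH; set y' := (2 * 3 ^ m)%:Z * h; pose n' := (2 * (3 ^ m * H))%N.
have N0 : (0 < 3 ^ m)%N by rewrite expn_gt0.
have rad : (2 * (r * H + (3 ^ m - 1) * `|h|) <= (2 * r + 1) * (3 ^ m * H))%N.
  by move: (3 ^ m)%N N0 => N N0; nia.
have -> : E (fun k => esc m k 0 0) ^+ 2 =
    E (fun k => esc m k 0 0) * E (fun k => esc m k n' y').
  by rewrite expect_escape expr2.
rewrite (_ : (fun k => esc m.+1 k 0 0) =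
    (fun k => esc m k 0 0 * esc m k n' y')); last first.
  by apply/funext => k; rewrite /esc /= add0n add0r.
apply: (expect_mix EP (f := fun k => esc m k 0 0) (g := fun k => esc m k n' y')
  (a := 0 - (r * H + (3 ^ m - 1) * `|h|%N)%:Z)
  (a' := y' - (r * H + (3 ^ m - 1) * `|h|%N)%:Z) (s := 0) (s' := n') lH).
- by [].
- by apply: polynomial_sub (polynomial_escape m _ _) => t x [h1 h2]; split; lia.
- by apply: polynomial_sub (polynomial_escape m _ _) => t x [h1 h2]; split; lia.
- by move=> k kP; exact: escape_01.
- by move=> k kP; exact: escape_01.
Qed.

Lemma polynomial_overspeed n y : polynomial everywhere (fun k => over k n y).
Proof. by apply: polynomialZ; exact: polynomial_ahead_everywhere. Qed.

Lemma polynomial_overspeed_sum m n y :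
  polynomial everywhere (fun k => over_sum m k n y).
Proof.
rewrite /over_sum; elim: m n y => [|m IH] n y /=.
  by apply: polynomialD; exact: polynomial_overspeed.
by apply: polynomialD => //; exact: polynomialD.
Qed.

Lemma expect_overspeed n y :
  E (fun k => over k n y) = gamma^-1 * fast_prob E H u.
Proof.
rewrite (expectZ EP) ?(expect_ahead _ _ _ _ EP) //.
exact: polynomial_ahead_everywhere.
Qed.

Lemma expect_overspeed_sum m n y :
  E (fun k => over_sum m k n y) = (3 ^ m * 2)%:R * (gamma^-1 * fast_prob E H u).
Proof.
rewrite /over_sum; elim: m n y => [|m IH] n y /=.
  rewrite (expectD EP); [|exact: polynomial_overspeed..].
  by rewrite !expect_overspeed mul1n; ring.
rewrite (expectD EP); [|by apply: polynomialD; exact: polynomial_overspeed_sum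
  |exact: polynomial_overspeed_sum].
rewrite (expectD EP); [|exact: polynomial_overspeed_sum..].
by rewrite !IH expnS !natrM; ring.
Qed.

Lemma fast_prob_le_escape m v :
  u * H%:R <= h%:~R -> b <= h%:~R - delay%:R ->
  ((3 ^ m)%:Z * h - delay%:Z)%:~R < v * (3 ^ m * H)%:R ->
  fast_prob E (3 ^ m * H) v <=
  E (fun k => esc m k 0 0) + (3 ^ m * 2)%:R * (gamma^-1 * fast_prob E H u).
Proof.
move=> uh bh hv; rewrite -(expect_overspeed_sum m 0 0) -(expectD EP).
- apply: (expect_le EP).
  + exact: polynomial_ahead_everywhere.
  + by apply: polynomialD; [exact: polynomial_escape_everywhere
                           |exact: polynomial_overspeed_sum].
  + by move=> k kP; exact: (ahead_le_escape gamma_gt0 H kP uh bh).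
- exact: polynomial_escape_everywhere.
- exact: polynomial_overspeed_sum.
Qed.

Lemma expect_escape0 v : b = - (v * H%:R) ->
  E (fun k => esc 0 k 0 0) =
  1 - gamma * fast_prob (fun f => E (fun k => f (flip_kernel k))) H v.
Proof.
move=> bE.
have ps : polynomial everywhere (fun k : kernel R r => slow H b k 0 0).
  exact: polynomial_everywhere (polynomial_quenched _ _ _ _ _).
rewrite (_ : (fun k => esc 0 k 0 0) = (fun k => 1 + (- gamma) * slow H b k 0 0)).
  rewrite (expectD EP) ?(expectZ EP) ?(expect_cst EP) ?mulNr //; first last.
  - exact: polynomialZ.
  - exact: polynomial_cst.
  congr (_ - _ * _); rewrite /fast_prob; congr E; apply/funext => k.
  rewrite /ahead quenched_flip oppr0 /slow; congr quenched.
  by apply/funext => z; rewrite add0r rmorphN /= bE lerNr.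
by apply/funext => k; rewrite /esc /= mulNr.
Qed.

End Fixed.
End TrapExpectation.

(** * Asymptotic estimates *)

Section Asymptotics.
Context (R : realType).

Lemma expr_small (g e : R) : 0 <= g < 1 -> 0 < e -> exists n, g ^+ n <= e.
Proof.
move=> /andP[g0 g1] e0.
have /cvgrPdist_lt /(_ e e0) [n _ /(_ n (leqnn n))] : (fun n => g ^+ n) @ \oo --> 0.
  by apply: cvg_expr; rewrite ger0_norm.
rewrite /= sub0r normrN ger0_norm ?exprn_ge0 // => /ltW h.
by exists n.
Qed.

(** The number [2 ^ m] of traps grows like a power of the time [3 ^ m], so the
    probability of avoiding all of them beats any power of [3 ^ m]. *)
Lemma double_expr_small (g K Q : R) : 0 <= g < 1 -> 0 < K -> 1 <= Q ->
  exists m, g ^+ (2 ^ m) * (K * Q ^+ m) <= 1.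
Proof.
move=> g01 K0 Q1; have /andP[g0 g1] := g01.
have Q0 : 0 < Q by lra.
have [n gn] : exists n, g ^+ n <= (2 * Q)^-1.
  by apply: expr_small => //; rewrite invr_gt0 mulr_gt0.
have gn2 : g ^+ (2 ^ n) * Q <= 2^-1.
  have -> : 2^-1 = (2 * Q)^-1 * Q by rewrite invfM mulfVK // gt_eqF.
  apply: ler_wpM2r; first exact: ltW.
  apply: le_trans gn; apply: ler_wiXn2l => //; first exact: ltW.
  by apply: ltnW; exact: ltn_expl.
have [t ht] : exists t, (2^-1 : R) ^+ t <= (K * Q ^+ n)^-1.
  apply: expr_small; last by rewrite invr_gt0 mulr_gt0 // exprn_gt0.
  by rewrite invr_ge0 ler0n invf_lt1 ?ltr0n // ltr1n.
exists (n + t)%N.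
apply: (@le_trans _ _ ((g ^+ (2 ^ n) * Q) ^+ t * (K * Q ^+ n))).
  rewrite exprMn exprD -!mulrA [Q ^+ t * _]mulrCA [Q ^+ t * _]mulrC.
  apply: ler_wpM2r; first by rewrite !mulr_ge0 ?exprn_ge0 // ltW.
  rewrite -exprM; apply: ler_wiXn2l => //; first exact: ltW.
  by rewrite expnD leq_mul2l; apply/orP; right; apply: ltnW; exact: ltn_expl.
apply: (@le_trans _ _ ((2^-1) ^+ t * (K * Q ^+ n))).
  apply: ler_wpM2r; first by rewrite mulr_ge0 ?exprn_ge0 // ltW.
  rewrite lerXn2r ?nnegrE ?invr_ge0 // mulr_ge0 ?exprn_ge0 // ltW //.
have KQ : 0 < K * Q ^+ n by rewrite mulr_gt0 ?exprn_gt0.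
by rewrite -ler_pdivlMr // mul1r.
Qed.

Context (theta : R) (theta_ge2 : 2 <= theta).

Lemma npow_ge_id n : n%:R <= npow theta n.
Proof.
case: n => [|n]; first exact: powR_ge0.
rewrite -[leLHS]powRr1 // /npow; apply: ler_powR; rewrite ?ler1n //.
by apply: le_trans theta_ge2; rewrite ler1n.
Qed.

Lemma inv_npow_small (c e : R) : 0 <= c -> 0 < e ->
  exists N, forall n, (N <= n)%N -> c / npow theta n <= e.
Proof.
move=> c0 e0; exists (Num.truncn (c / e)).+1 => n Nn.
have n0 : (0 < n)%N by lia.
rewrite ler_pdivrMr ?npow_gt0 // mulrC -ler_pdivrMr //.
apply: le_trans (npow_ge_id n).
apply: (@le_trans _ _ (Num.truncn (c / e)).+1%:R); last by rewrite ler_nat.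
by rewrite ltW // truncnS_gt.
Qed.

Lemma inv_npow4_small (c e : R) : 0 <= c -> 0 < e ->
  exists N, forall n, (N <= n)%N -> c / npow theta n ^+ 4 <= e.
Proof.
move=> c0 e0; have [N HN] := inv_npow_small c0 e0.
exists N.+1 => n Nn; apply: le_trans (HN n (ltnW Nn)).
have n0 : (0 < n)%N by lia.
have p1 : 1 <= npow theta n.
  by apply: le_trans (npow_ge_id n); rewrite ler1n.
apply: ler_wpM2l => //; rewrite lef_pV2 ?posrE ?exprn_gt0 ?npow_gt0 //.
by rewrite -[leLHS]expr1; apply: ler_weXn2l.
Qed.

End Asymptotics.

(** * Extremal speeds *)

Section Speed.
Context (R : realType) (theta : R) (theta_ge2 : 2 <= theta).
Context (r : nat) (gamma c0 : R) (l : nat).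
Context (r_gt0 : (0 < r)%N) (gamma_gt0 : 0 < gamma) (c0_ge0 : 0 <= c0).
Let pow := npow theta.
Let err (H : nat) : R := c0 / pow H ^+ 4.

Definition decays (E : (kernel R r -> R) -> R) (v : R) : Prop :=
  exists2 c, 0 < c & forall n, (1 <= n)%N -> fast_prob E n v <= c / npow theta n.

Section OneSided.
Context (E : (kernel R r -> R) -> R) (EP : kernel_expectation gamma l err E).

Lemma decays_mono v v' : v <= v' -> decays E v -> decays E v'.
Proof.
move=> vv' [c cgt0 cP]; exists c => // n n1; apply: le_trans (cP n n1).
exact: (fast_prob_mono gamma_gt0 EP).
Qed.

(** By [fast_prob_decay], small values at a single large scale would propagate. *)
Lemma fast_prob_ge_of_not_decays v eta :
  ~ decays E (v + eta) -> - r%:R <= v -> 0 < eta ->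
  exists2 c, 0 < c & exists N, forall H, (N <= H)%N -> c <= fast_prob E H v.
Proof.
move=> nd vr eta0.
pose L := maxn 16 (Num.truncn (2 * (6 * r + 2)%:R / eta)).+1.
have L16 : (16 <= L)%N by rewrite leq_max leqnn.
have L0 : (0 < L)%N by lia.
have Leta : 2 * (6 * r + 2)%:R / L%:R <= eta.
  rewrite ler_pdivrMr ?ltr0n // -ler_pdivrMl // mulrC; apply: ltW.
  by apply: (lt_le_trans (truncnS_gt _)); rewrite ler_nat leq_max leqnn orbT.
pose a := trigger_level theta r gamma L.
have a0 : 0 < a by exact: trigger_level_gt0.
have [N HN] := inv_npow4_small theta_ge2 c0_ge0 (exprn_gt0 2 a0).
exists a => //; exists (maxn N (maxn l.+1 (2 * L ^ 2))) => H.
rewrite !geq_max => /and3P[NH lH LH]; rewrite leNgt; apply/negP => /ltW pa.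
apply: nd; apply: decays_mono (lerD (lexx v) Leta) _.
exact: (fast_prob_decay theta_ge2 r_gt0 gamma_gt0 c0_ge0 EP L16 vr lH LH
  (HN H NH) pa).
Qed.

(** The set of the speeds [v] with decay is an up-set that contains [v > r] and
    no [v < - r]; [vp] is its infimum. *)
Lemma top_speed_exists : exists2 vp, - r%:R <= vp <= r%:R &
  (forall v, vp < v -> decays E v) /\ (forall v, v < vp -> ~ decays E v).
Proof.
pose V := [set v | decays E v].
have Vr v : r%:R < v -> V v.
  move=> rv; exists 1 => // n n1.
  rewrite (@le_trans _ _ 0) ?mulr_ge0 ?invr_ge0 ?powR_ge0 //.
  rewrite -(expect_cst EP 0); apply: (expect_le EP).
  - exact: polynomial_ahead_everywhere.
  - exact: polynomial_cst.
  - move=> k kP; rewrite (ahead_eq0 gamma_gt0 kP) //.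
    by rewrite mulr0z add0r natrM ltr_pM2r ?ltr0n.
have rV v : V v -> - r%:R <= v.
  move=> [c cgt0 cP]; rewrite leNgt; apply/negP => vr.
  have [N HN] := @inv_npow_small R theta theta_ge2 c (2^-1) (ltW cgt0) ltac:(lra).
  have := le_trans (cP N.+1 isT) (HN _ (leqnSn _)).
  apply/negP; rewrite -ltNge; apply: (@lt_le_trans _ _ 1); first by lra.
  rewrite -(expect_cst EP 1); apply: (expect_le EP).
  - exact: polynomial_cst.
  - exact: polynomial_ahead_everywhere.
  - move=> k kP; rewrite -[leLHS](quenched_cst kP N.+1 0 1 0).
    apply: (quenched_le gamma_gt0 kP) => y /andP[ry _].
    suff -> : v * N.+1%:R <= y%:~R by [].
    apply: (@le_trans _ _ (- (r * N.+1)%:Z)%:~R).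
      by rewrite mulrNz -pmulrn natrM -mulNr ler_wpM2r // ltW.
    by rewrite ler_int; lia.
have Vinf : has_inf V.
  split; first by exists (r%:R + 1); apply: Vr; lra.
  by exists (- r%:R) => v /rV.
exists (inf V).
  apply/andP; split; first by apply: lb_le_inf; [case: Vinf|move=> v /rV].
  rewrite leNgt; apply/negP => rinf.
  have : inf V <= (r%:R + inf V) / 2 by apply: ge_inf; [case: Vinf|apply: Vr; lra].
  by lra.
split=> v vp; last by move=> /(ge_inf Vinf.2); lra.
have [w Vw wv] := inf_adherent (eps := v - inf V) ltac:(lra) Vinf.
by apply: decays_mono Vw; lra.
Qed.

End OneSided.

(** Induction on [m] through [expect_escape_rec]: squaring turns
    [g ^+ (2 ^ m)] into [g ^+ (2 ^ m.+1)], and the mixing errors vanish at large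
    scales.  The bound is uniform in the trap parameters [h] and [b], which
    depend on the scale. *)
Lemma escape_small m e : 0 < e -> exists N, forall E : (kernel R r -> R) -> R,
  kernel_expectation gamma l err E ->
  forall H h b g, (N <= H)%N -> (2 * `|h| <= (2 * r + 1) * H)%N -> 0 <= g <= 1 ->
  E (fun k => escape gamma H h b 0 k 0 0) <= g ->
  E (fun k => escape gamma H h b m k 0 0) <= g ^+ (2 ^ m) + e.
Proof.
elim: m e => [|m IH] e e0.
  by exists 0%N => E EP H h b g _ _ _ Eg; rewrite expn0 expr1; lra.
pose e' := Num.min 1 (e / 4).
have e'0 : 0 < e' by rewrite lt_min ltr01 divr_gt0.
have e'1 : e' <= 1 by rewrite ge_min lexx.
have e'e : e' <= e / 4 by rewrite ge_min lexx orbT.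
have [N1 HN1] := IH e' e'0.
have [N2 HN2] := inv_npow4_small theta_ge2 c0_ge0 e'0.
exists (maxn N1 (maxn N2 l.+1)) => E EP H h b g.
rewrite !geq_max => /and3P[N1H N2H lH] hH g01 Eg.
have /andP[g0 g1] := g01.
have N30 : (H <= 3 ^ m * H)%N by rewrite leq_pmull // expn_gt0.
apply: le_trans (expect_escape_rec gamma_gt0 EP b (leq_trans lH N30) hH) _.
have h1 := HN1 E EP H h b g N1H hH g01 Eg.
have h2 := HN2 _ (leq_trans N2H N30).
set x := E _ in h1 *; set y := g ^+ (2 ^ m) in h1.
have x0 : 0 <= x.
  rewrite -(expect_cst EP 0); apply: (expect_le EP).
  - exact: polynomial_cst.
  - exact: polynomial_escape_everywhere.
  - by move=> k kP; have /andP[] := escape_01 gamma_gt0 H h b kP m 0 0.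
have -> : g ^+ (2 ^ m.+1) = y ^+ 2 by rewrite -exprM expnSr.
have y0 : 0 <= y by exact: exprn_ge0.
have y1 : y <= 1 by exact: exprn_ile1.
apply: (@le_trans _ _ ((y + e') ^+ 2 + e')).
  have ye : 0 <= y + e' by rewrite addr_ge0 // ltW.
  by apply: lerD => //; rewrite lerXn2r ?nnegrE.
have : e' * e' <= e' * 1 by rewrite ler_pM2l.
have : y * e' <= 1 * e' by rewrite ler_pM2r.
by rewrite sqrrD; lra.
Qed.

End Speed.

(** * Coincidence of the extremal speeds *)

Section AbstractLLN.
Context (R : realType) (theta : R) (theta_ge2 : 2 <= theta).
Context (r : nat) (gamma c0 : R) (l : nat).
Context (r_gt0 : (0 < r)%N) (gamma_gt0 : 0 < gamma) (c0_ge0 : 0 <= c0).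
Let pow := npow theta.
Let err (H : nat) : R := c0 / pow H ^+ 4.
Context (E : (kernel R r -> R) -> R) (EP : kernel_expectation gamma l err E).
Let Ef (f : kernel R r -> R) : R := E (fun k => f (flip_kernel k)).

Let EfP : kernel_expectation gamma l err Ef := kernel_expectation_flip EP.

Lemma common_upper_bound (a1 a2 a3 a4 a5 a6 a7 a8 : nat) : exists n,
  [/\ (a1 <= n)%N, (a2 <= n)%N, (a3 <= n)%N & (a4 <= n)%N] /\
  [/\ (a5 <= n)%N, (a6 <= n)%N, (a7 <= n)%N & (a8 <= n)%N].
Proof. by exists (a1 + a2 + a3 + a4 + a5 + a6 + a7 + a8)%N; split; split; lia. Qed.

(** If [vp + mu > 0], being delayed has a probability bounded below at every
    large scale; the traps then make the speed [vp - eta / 3 ^ m] so unlikely that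
    the renormalization lowers [vp]. *)
Lemma top_speeds_le0 (vp mu : R) :
  - r%:R <= vp <= r%:R -> - r%:R <= mu <= r%:R ->
  (forall v, vp < v -> decays theta E v) ->
  (forall v, v < vp -> ~ decays theta E v) ->
  (forall v, v < mu -> ~ decays theta Ef v) ->
  vp + mu <= 0.
Proof.
move=> /andP[vp1 vp2] /andP[mu1 mu2] above below belowf.
rewrite leNgt; apply/negP => gap.
pose eta := (vp + mu) / 4; have eta0 : 0 < eta by rewrite divr_gt0.
have etaE : vp + mu = 4 * eta by rewrite /eta; field.
have [c cgt0 [N1 HN1]] : exists2 c, 0 < c &
    exists N, forall H, (N <= H)%N -> c <= fast_prob Ef H (mu - eta).
  apply: (fast_prob_ge_of_not_decays theta_ge2 r_gt0 gamma_gt0 c0_ge0 EfP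
    (eta := eta / 2)); [apply: belowf| |]; lra.
have c1 : c <= 1.
  apply: le_trans (HN1 N1 (leqnn _)) _.
  by have /andP[] := fast_prob_01 gamma_gt0 EfP N1 (mu - eta).
have [k0 k0P] : exists k : kernel R r, elliptic gamma k.
  apply: contrapT => nok.
  have : (1 : R) <= 0; last by rewrite ler10.
  rewrite -(expect_cst EP 1) -(expect_cst EP 0); apply: (expect_le EP).
  - exact: polynomial_cst.
  - exact: polynomial_cst.
  - by move=> k kP; exfalso; apply: nok; exists k.
have g1 := gamma_le1 gamma_gt0 k0P.
pose g := 1 - gamma * c.
have gc0 : 0 < gamma * c by rewrite mulr_gt0.
have gc1 : gamma * c <= 1 by rewrite -[leRHS]mulr1 ler_pM // ltW.
have g01 : 0 <= g < 1 by rewrite /g; lra.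
pose K : R := (6 * r + 2)%:R.
pose L1 := maxn 16 (Num.truncn (4 * K / eta)).+1.
have L16 : (16 <= L1)%N by rewrite leq_max leqnn.
have L1_gt0 : (0 < L1)%N by exact: leq_trans L16.
have L1eta : 4 * K / L1%:R <= eta.
  rewrite ler_pdivrMr ?ltr0n // -ler_pdivrMl // mulrC; apply: ltW.
  by apply: (lt_le_trans (truncnS_gt _)); rewrite ler_nat leq_max leqnn orbT.
pose C2 : R := 81 * r%:R ^+ 2 / gamma ^+ 2.
have C2_gt0 : 0 < C2 by rewrite !mulr_gt0 ?invr_gt0 ?exprn_gt0 ?ltr0n.
(* the number of traps is chosen first, then the excess of speed [eps] of the
   line of traps, and the scale [H] last *)
have [m Hm] : exists m,
    g ^+ (2 ^ m) <= trigger_level theta r gamma (L1 * 3 ^ m) / 3.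
  have [m Hm] : exists m, g ^+ (2 ^ m) *
      ((3 * (2 * C2 * (L1%:R ^+ 6 * pow L1 ^+ 2))) *
       (3%:R ^+ 6 * pow 3 ^+ 2) ^+ m) <= 1.
    apply: double_expr_small => //.
      have L1p : 0 < L1%:R ^+ 6 * pow L1 ^+ 2.
        by rewrite mulr_gt0 ?exprn_gt0 ?ltr0n // npow_gt0.
      by apply: mulr_gt0 => //; apply: mulr_gt0 => //; exact: mulr_gt0.
    have p3 : 1 <= pow 3 by apply: le_trans (npow_ge_id theta_ge2 3); rewrite ler1n.
    rewrite -[leLHS]mulr1; apply: ler_pM => //.
      by rewrite exprn_ege1 // ler1n.
    by rewrite exprn_ege1.
  have powX n : pow (3 ^ n) = pow 3 ^+ n.
    elim: n => [|n IH]; first by rewrite expn0 expr0 /pow npow1.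
    by rewrite expnS exprS -IH /pow npowM.
  exists m; have a0 := trigger_level_gt0 theta r_gt0 gamma_gt0
    (L := L1 * 3 ^ m) ltac:(by rewrite muln_gt0 L1_gt0 expn_gt0).
  rewrite ler_pdivlMr // -[leRHS]mul1r -ler_pdivrMr //; move: Hm.
  rewrite /trigger_level invrK -/pow -/C2.
  suff -> : 3 * (2 * C2 * (L1%:R ^+ 6 * pow L1 ^+ 2)) *
       (3%:R ^+ 6 * pow 3 ^+ 2) ^+ m =
       3 * (2 * C2 * ((L1 * 3 ^ m)%:R ^+ 6 * pow (L1 * 3 ^ m) ^+ 2)).
    by rewrite [g ^+ _ * (3 * _)]mulrA.
  rewrite [pow (_ * _)]npowM -/pow powX natrM natrX !exprMn.
  by move: (3%:R ^+ m) (pow 3 ^+ m) => x y; ring.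
set a := trigger_level _ _ _ _ in Hm.
pose N := (3 ^ m)%N; have N_gt0 : (0 < N)%N by rewrite expn_gt0.
have NR : 0 < N%:R :> R by rewrite ltr0n.
pose L := (L1 * N)%N.
have L_gt0 : (0 < L)%N by rewrite muln_gt0 L1_gt0.
have a0 : 0 < a by exact: trigger_level_gt0.
(* over [N] slabs, a walk below the line gains at most [eta / 4 * H] (and
   rounding errors) on the speed [vp], less than the delay [2 * eta * H] caused by a trap *)
pose eps := Num.min (4^-1) (eta / (4 * N%:R)).
have eps0 : 0 < eps by rewrite lt_min invr_gt0 ltr0n divr_gt0 ?mulr_gt0.
have eps4 : eps <= 4^-1 by rewrite ge_min lexx.
have epsN : N%:R * eps <= eta / 4.
  have : eps <= eta / (4 * N%:R) by rewrite ge_min lexx orbT.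
  by rewrite -(ler_pM2l NR) => /le_trans; apply; rewrite le_eqVlt;
    apply/orP; left; apply/eqP; field; rewrite gt_eqF.
have a30 : 0 < a / 3 by rewrite divr_gt0.
have [c' c'0 Hc'] := above (vp + eps) ltac:(lra).
have [N2 HN2] := escape_small theta_ge2 r l gamma_gt0 c0_ge0 m a30.
have [N3 HN3] : exists N3, forall H, (N3 <= H)%N ->
    (N * 2)%:R * gamma^-1 * c' / pow H <= a / 3.
  apply: (inv_npow_small theta_ge2) => //.
  by rewrite !mulr_ge0 ?invr_ge0 // ltW.
have [N4 HN4] := inv_npow4_small theta_ge2 c0_ge0 (exprn_gt0 2 a0).
pose N5 := (Num.truncn ((N%:R + 1) * 2 / eta)).+1.
have [H [[N1H N2H N3H N4H] [N5H lH LH H4]]] :=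
  common_upper_bound N1 N2 N3 N4 N5 l.+1 (2 * L ^ 2) 4.
have H5 : (N%:R + 1) * 2 <= eta * H%:R.
  rewrite -ler_pdivrMl // mulrC; apply: ltW.
  by apply: (lt_le_trans (truncnS_gt _)); rewrite ler_nat.
have HR : 4 <= H%:R :> R by rewrite ler_nat.
pose u := vp + eps; pose h := Num.ceil (u * H%:R).
have uh : u * H%:R <= h%:~R by exact: ceil_ge.
have hu : h%:~R < u * H%:R + 1.
  by have := ceilB1_lt (u * H%:R); rewrite -/h rmorphB /=; lra.
pose delay := Num.truncn (2 * eta * H%:R).
have /andP[delay1 delay2] :
    (delay%:R : R) <= 2 * eta * H%:R < delay.+1%:R.
  by apply: truncn_itv; rewrite !mulr_ge0 // ltW.
rewrite -natr1 in delay2.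
pose b := - ((mu - eta) * H%:R).
have bh : b <= h%:~R - delay%:R.
  have := mulr_gt0 eps0 (lt_le_trans (ltr0n R 4) HR).
  have : mu * H%:R + vp * H%:R = 4 * eta * H%:R by rewrite -mulrDl addrC etaE.
  move: uh delay1; rewrite /u /b mulrDl; lra.
have hH : (2 * `|h| <= (2 * r + 1) * H)%N.
  rewrite -(ler_nat R) !natrM natrD natrM -[`|h|%:R]/(`|h|%N%:Z%:~R).
  rewrite abszE intr_norm.
  have h1 : - (r%:R * H%:R) <= h%:~R :> R.
    apply: le_trans uh; rewrite -mulNr ler_wpM2r // /u; lra.
  have h2 : h%:~R <= r%:R * H%:R + H%:R / 2 :> R.
    apply: (le_trans (ltW hu)); rewrite /u mulrDl.
    have : vp * H%:R <= r%:R * H%:R by rewrite ler_wpM2r.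
    have : eps * H%:R <= 4^-1 * H%:R by rewrite ler_wpM2r.
    lra.
  have : `|h%:~R| <= r%:R * H%:R + H%:R / 2 :> R.
    by rewrite ler_norml h2 andbT; lra.
  lra.
pose v := vp - eta / N%:R.
have hv : (N%:Z * h - delay%:Z)%:~R < v * (N * H)%:R.
  have -> : v * (N * H)%:R = N%:R * (vp * H%:R) - eta * H%:R.
    by rewrite /v natrM; field; rewrite gt_eqF.
  rewrite rmorphB rmorphM /= -!pmulrn.
  have h1 : N%:R * h%:~R <= N%:R * (u * H%:R + 1) by rewrite ler_pM2l // ltW.
  have h2 : N%:R * (u * H%:R + 1) = N%:R * (vp * H%:R) + N%:R * eps * H%:R + N%:R.
    by rewrite /u; ring.
  have h3 : N%:R * eps * H%:R <= eta / 4 * H%:R by rewrite ler_wpM2r.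
  lra.
have pNH : fast_prob E (N * H) v <= a.
  apply: le_trans (fast_prob_le_escape gamma_gt0 EP uh bh hv) _.
  have e1 : E (fun k => escape gamma H h b m k 0 0) <= a / 3 + a / 3.
    apply: le_trans (HN2 E EP H h b g N2H hH _ _) _.
    - by have /andP[-> /ltW] := g01.
    - rewrite (expect_escape0 EP h (v := mu - eta)) // /g lerD2l lerN2.
      by rewrite ler_pM2l //; exact: HN1.
    - by rewrite lerD2r.
  have e2 : (N * 2)%:R * (gamma^-1 * fast_prob E H u) <= a / 3.
    apply: le_trans (HN3 H N3H); rewrite mulrA -[leRHS]mulrA.
    apply: ler_wpM2l; last by apply: Hc'; exact: leq_trans H4.
    by rewrite mulr_ge0 ?invr_ge0 // ltW.
  by rewrite -/N; lra.
have NH : (H <= N * H)%N by rewrite leq_pmull.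
apply: (below (v + 2 * K / L%:R)).
  rewrite /v /L natrM.
  have -> : 2 * K / (L1%:R * N%:R) = 4 * K / L1%:R / N%:R / 2.
    by field; rewrite !gt_eqF ?ltr0n.
  have : 4 * K / L1%:R / N%:R <= eta / N%:R by rewrite ler_wpM2r ?invr_ge0.
  have : 0 < eta / N%:R by rewrite divr_gt0.
  lra.
apply: (fast_prob_decay theta_ge2 r_gt0 gamma_gt0 c0_ge0 EP (H0 := N * H)) => //.
- by rewrite (leq_trans L16) // leq_pmulr.
- rewrite /v; have : eta / N%:R <= eta.
    by rewrite ler_pdivrMr // -[leLHS]mulr1 ler_pM2l // ler1n.
  lra.
- exact: leq_trans NH.
- exact: leq_trans NH.
- by apply: HN4; exact: leq_trans NH.
Qed.

Theorem speed_exists : exists2 nu, - r%:R <= nu <= r%:R &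
  forall eps, 0 < eps -> decays theta E (nu + eps) /\ decays theta Ef (- nu + eps).
Proof.
have [vp vpr [above below]] :=
  top_speed_exists theta_ge2 r_gt0 gamma_gt0 c0_ge0 EP.
have [mu mur [abovef belowf]] :=
  top_speed_exists theta_ge2 r_gt0 gamma_gt0 c0_ge0 EfP.
have := top_speeds_le0 vpr mur above below belowf.
by exists vp => // eps eps0; split; [apply: above|apply: abovef]; lra.
Qed.

End AbstractLLN.

(** * Reindexing in product topologies *)

Section Reindexing.
Context (S : ptopologicalType).

Lemma coordinate_continuous (I : Type) (i : I) :
  continuous (fun f : prod_topology (fun _ : I => S) => f i).
Proof.
move=> f; have /cvg_sup/(_ i) ff : f --> f by exact: cvg_id.
apply: cvg_trans (@initial_continuous (I -> S) S (fun f => f i) f).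
exact: cvg_app ff.
Qed.

Lemma reindex_continuous (I J : Type) (phi : J -> I) :
  continuous (fun f : prod_topology (fun _ : I => S) =>
    (fun j => f (phi j)) : prod_topology (fun _ : J => S)).
Proof.
move=> f; apply/cvg_sup => j.
apply: (@continuous_comp_initial (prod_topology (fun _ : J => S))
  (prod_topology (fun _ : I => S)) S (fun f => f j)
  (fun f j => f (phi j))).
exact: coordinate_continuous.
Qed.

Lemma reindex_measurable (I J : Type) (phi : J -> I) :
  measurable_fun setT
    (fun f : borel_fun S I => (fun j => f (phi j)) : borel_fun S J).
Proof.
apply: (@measurability _ _ (borel_fun S I) (borel_fun S J) _ _
  (@open (prod_topology (fun _ : J => S)))) => //.
move=> _ [B oB <-]; rewrite setTI; apply: sub_sigma_algebra.
move/continuousP: (@reindex_continuous I J phi) => cphi.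
exact: cphi.
Qed.

End Reindexing.

(** * The kernel of an environment *)

Section EnvironmentKernel.
Context (S : ptopologicalType) (R : realType) (l r : nat).
Context (g : window S l -> R -> int) (gP : jump_function r g).

Definition env_kernel (e : env S) : kernel R r :=
  fun n x i => fine (jump_prob g (view e n x) (jump i)).

Let jump_set (x : int) : set (window S l * measurableTypeR R) :=
  (setT `*` `[0, 1]) `&` [set p | g p.1 p.2 = x].

Lemma xsection_jump_set x s :
  xsection (jump_set x) s = `[0, 1] `&` [set u | g s u = x].
Proof.
apply/seteqP; split=> u; rewrite /xsection /= inE.
  by move=> [[_ u01] gu].
by move=> [u01 gu]; split.
Qed.

(** Sections of the set in [gP]; measurability of the jump law is then the one of
    the measure of sections. *)
Lemma measurable_jump_event s x :
  measurable (`[0, 1] `&` [set u : measurableTypeR R | g s u = x]).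
Proof.
by rewrite -xsection_jump_set; apply: measurable_xsection; exact: gP.2.
Qed.

Lemma jump_probE s x : jump_prob g s x =
  uniform_prob (@ltr01 R) (xsection (jump_set x) s).
Proof. by rewrite xsection_jump_set. Qed.

Lemma measurable_jump_prob x :
  measurable_fun [set: window S l] (fun s => fine (jump_prob g s x)).
Proof.
apply: (measurableT_comp (@fine_measurable R setT measurableT)).
rewrite (_ : jump_prob g ^~ x =
  uniform_prob (@ltr01 R) \o xsection (jump_set x)); last first.
  by apply/funext => s /=; exact: jump_probE.
by apply: measurable_fun_xsection; exact: gP.2.
Qed.

Lemma jump_prob_fin s x : jump_prob g s x \is a fin_num.
Proof.
by rewrite /jump_prob; apply: fin_num_measure; exact: measurable_jump_event.
Qed.

Lemma uniform_prob_unit : uniform_prob (@ltr01 R) `[0, 1] = 1%E.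
Proof.
rewrite -(@probability_setT _ _ R (uniform_prob (@ltr01 R))) /uniform_prob.
rewrite integral_mkcond; apply: eq_integral => u _.
rewrite patchE; case: ifPn => //; rewrite notin_setE /= in_itv /= => /negP u01.
by rewrite /uniform_pdf (negbTE u01).
Qed.

Lemma jump_prob_sum s : (\sum_(i < r.*2.+1) jump_prob g s (jump i) = 1)%E.
Proof.
rewrite /jump_prob -(measure_bigsetU_ord (uniform_prob (@ltr01 R)) predT
  (F := fun i => `[0, 1] `&` [set u | g s u = jump i])); last 2 first.
- by move=> i; exact: measurable_jump_event.
- move=> i j _ _ [u [[_ /= gi] [_ /= gj]]]; apply/val_inj.
  have : jump i = jump j by rewrite -gi -gj.
  by rewrite /jump /=; lia.
rewrite -[RHS]uniform_prob_unit; congr uniform_prob.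
rewrite -bigcup_seq; apply/seteqP; split=> u /=; first by move=> [i _ []].
move=> u01; have [i Hi] := jump_surj (gP.1 s u u01).
by exists i; [rewrite /= mem_index_enum|split].
Qed.

Lemma env_kernel_elliptic : uniformly_elliptic r g ->
  exists2 gamma, 0 < gamma & forall e, elliptic gamma (env_kernel e).
Proof.
move=> [gamma gamma0 Hg]; exists gamma => // e n x; split=> [i|].
  rewrite -lee_fin fineK ?jump_prob_fin //.
  have inf_le : (ereal_inf [set jump_prob g s (jump i) | s in [set: window S l]]
      <= jump_prob g (view e n x) (jump i))%E.
    by apply: ereal_inf_lbound; exists (view e n x).
  apply: (le_trans Hg); apply: le_trans inf_le; apply: ereal_inf_lbound.
  by exists (jump i) => //=; exact: jump_bound.
have := jump_prob_sum (view e n x).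
rewrite -[LHS](eq_bigr _ (fun i _ => fineK (jump_prob_fin (view e n x) (jump i)))).
by rewrite sumEFin => -[].
Qed.

Lemma env_kernel_shift x0 t0 e :
  env_kernel (shift_env x0 t0 e) = shift_kernel x0 t0 (env_kernel e).
Proof.
apply/funext => n; apply/funext => x; apply/funext => i.
rewrite /env_kernel /shift_kernel; congr (fine (jump_prob g _ _)).
by apply/funext => j; rewrite /view /shift_env !addrA.
Qed.

Section Measurability.
Context d (Omega : measurableType d) (omega : Omega -> env S).

(** The view from [x] is a reindexing of the slice of the environment in [A]. *)
Lemma measurable_view (A : set (int * nat)) n x :
  (forall y, x - l%:Z <= y <= x + l%:Z -> A (y, n)) ->
  measurable_fun setT ((fun w => view (omega w) n x) :
    g_sigma_algebraType (restr_gen omega A) -> window S l).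
Proof.
move=> xA _ B mB.
have iA (i : 'I_(l.*2.+1)) : A (x - l%:Z + (i : nat)%:Z, n).
  by apply: xA; case: i => i /= Hi; lia.
pose phi (i : 'I_(l.*2.+1)) : {y | A (y, n)} := exist _ _ (iA i).
apply: sub_sigma_algebra; exists n => //.
exists ((fun f : borel_fun S {y | A (y, n)} =>
  (fun i => f (phi i)) : borel_fun S 'I_(l.*2.+1)) @^-1` B) => //.
by have := @reindex_measurable S _ _ phi measurableT B mB; rewrite setTI.
Qed.

Lemma measurable_env_kernel (A : set (int * nat)) n x i :
  (forall y, x - l%:Z <= y <= x + l%:Z -> A (y, n)) ->
  measurable_fun setT ((fun w => env_kernel (omega w) n x i) :
    g_sigma_algebraType (restr_gen omega A) -> R).
Proof.
move=> xA; rewrite /env_kernel.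
exact: (measurableT_comp (measurable_jump_prob (jump i)) (measurable_view xA)).
Qed.

Lemma measurable_polynomial D (A : set (int * nat)) f :
  (forall n x, D n x -> forall y, x - l%:Z <= y <= x + l%:Z -> A (y, n)) ->
  polynomial D f ->
  measurable_fun setT ((fun w => f (env_kernel (omega w))) :
    g_sigma_algebraType (restr_gen omega A) -> R).
Proof.
move=> DA; elim=> [c|n x i /DA|f1 f2 _ m1 _ m2|f1 f2 _ m1 _ m2].
- exact: measurable_cst.
- exact: measurable_env_kernel.
- exact: measurable_funD.
- exact: measurable_funM.
Qed.

Lemma restr_gen_measurable A : measurable_fun setT omega ->
  <<s restr_gen omega A >> `<=` measurable.
Proof.
move=> momega; apply: smallest_sub; first exact: sigma_algebra_measurable.
move=> _ [t _ [B mB <-]].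
have mt : measurable_fun setT (fun e : env S => e t : borel_fun S int).
  move=> _ C mC; apply: sub_sigma_algebra; exists t => //.
  by exists C.
have mr := measurableT_comp (measurableT_comp
  (@reindex_measurable S _ _ (fun x : {x | A (x, t)} => sval x)) mt) momega.
exact: mr.
Qed.

Lemma measurable_polynomial_everywhere f : measurable_fun setT omega ->
  polynomial everywhere f ->
  measurable_fun setT (fun w => f (env_kernel (omega w))).
Proof.
move=> momega fp _ B mB.
apply: (@restr_gen_measurable setT momega).
exact: (@measurable_polynomial everywhere setT f (fun _ _ _ _ _ => I) fp).
Qed.

End Measurability.

Lemma measurable_shift_env x0 t0 :
  measurable_fun setT (@shift_env S x0 t0).
Proof.
apply: (@measurability _ _ (env S) (env S) _ _ (@env_gen S)) => //.
move=> _ [_ [t _ [B mB <-]] <-]; rewrite !setTI.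
have mt : measurable_fun setT (fun e : env S => e (t0 + t)%N : borel_fun S int).
  move=> _ C mC; apply: sub_sigma_algebra; exists (t0 + t)%N => //.
  by exists C.
have := measurableT_comp
  (@reindex_measurable S _ _ (fun x : int => x0 + x)) mt.
by move=> /(_ measurableT B mB); rewrite setTI.
Qed.

End EnvironmentKernel.

(** * Expectations of bounded functions *)

Section Mean.
Context (R : realType) d (Omega : measurableType d) (P : probability Omega R).

Definition mean (h : Omega -> R) : R := \int[P]_w h w.

Definition bounded_measurable (h : Omega -> R) : Prop :=
  measurable_fun setT h /\ exists M, forall w, `|h w| <= M.

Lemma bounded_measurable_integrable h :
  bounded_measurable h -> P.-integrable setT (EFin \o h).
Proof.
move=> [mh [M hM]]; apply: measurable_bounded_integrable => //.
  exact: fin_num_fun_lty (fin_num_measure P).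
exists M; split; first exact: num_real.
by move=> M' MM' w _; apply: (le_trans (hM w)); exact: ltW.
Qed.

Lemma bounded_measurable_cst c : bounded_measurable (fun=> c).
Proof. by split; [exact: measurable_cst|exists `|c|]. Qed.

Lemma bounded_measurableD h1 h2 :
  bounded_measurable h1 -> bounded_measurable h2 ->
  bounded_measurable (fun w => h1 w + h2 w).
Proof.
move=> [m1 [M1 b1]] [m2 [M2 b2]]; split; first exact: measurable_funD.
by exists (M1 + M2) => w; apply: (le_trans (ler_normD _ _)); exact: lerD.
Qed.

Lemma bounded_measurableM h1 h2 :
  bounded_measurable h1 -> bounded_measurable h2 ->
  bounded_measurable (fun w => h1 w * h2 w).
Proof.
move=> [m1 [M1 b1]] [m2 [M2 b2]]; split; first exact: measurable_funM.
by exists (M1 * M2) => w; rewrite normrM ler_pM.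
Qed.

Lemma bounded_measurable_sum (I : Type) (s : seq I) (F : I -> Omega -> R) :
  (forall i, bounded_measurable (F i)) ->
  bounded_measurable (fun w => \sum_(i <- s) F i w).
Proof.
move=> bF; elim: s => [|i s IH].
  by under eq_fun do rewrite big_nil; exact: bounded_measurable_cst.
by under eq_fun do rewrite big_cons; exact: bounded_measurableD.
Qed.

Lemma mean_cst c : mean (fun=> c) = c.
Proof.
rewrite /mean Rintegral_cst // (_ : fine _ = 1) ?mulr1 //.
exact: (congr1 fine (probability_setT P)).
Qed.

Lemma meanD h1 h2 : bounded_measurable h1 -> bounded_measurable h2 ->
  mean (fun w => h1 w + h2 w) = mean h1 + mean h2.
Proof.
by move=> b1 b2; rewrite /mean RintegralD //; exact: bounded_measurable_integrable.
Qed.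

Lemma meanZ c h : bounded_measurable h -> mean (fun w => c * h w) = c * mean h.
Proof.
by move=> b; rewrite /mean RintegralZl //; exact: bounded_measurable_integrable.
Qed.

Lemma mean_le h1 h2 : bounded_measurable h1 -> bounded_measurable h2 ->
  (forall w, h1 w <= h2 w) -> mean h1 <= mean h2.
Proof.
move=> b1 b2 h12; apply: le_Rintegral => //;
  exact: bounded_measurable_integrable.
Qed.

Lemma mean_sum (I : Type) (s : seq I) (F : I -> Omega -> R) :
  (forall i, bounded_measurable (F i)) ->
  mean (fun w => \sum_(i <- s) F i w) = \sum_(i <- s) mean (F i).
Proof.
move=> bF; elim: s => [|i s IH].
  by rewrite big_nil; under eq_fun do rewrite big_nil; exact: mean_cst.
rewrite big_cons -IH -meanD //; last exact: bounded_measurable_sum.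
by congr mean; apply/funext => w; rewrite big_cons.
Qed.

Lemma expectation_mean h : bounded_measurable h -> 'E_P[h]%E = (mean h)%:E.
Proof.
move=> b; rewrite unlock /mean /Rintegral fineK //.
by apply: integrable_fin_num => //; exact: bounded_measurable_integrable.
Qed.

Lemma sum_ord_lt N T : (\sum_(i < N) (i < T : nat) = minn N T)%N.
Proof.
elim: N => [|N IH]; first by rewrite big_ord0 min0n.
by rewrite big_ord_recr /= IH; lia.
Qed.

(** Approximation from below of a [0, 1]-valued quantity by an average of
    indicators of superlevel sets: a decorrelation inequality for indicators
    thus extends to [0, 1]-valued functions. *)
Definition level_average (N : nat) (x : R) : R :=
  N%:R^-1 * \sum_(i < N) ((i.+1%:R / N%:R <= x)%R%:R).

Lemma level_averageP N x : (0 < N)%N -> 0 <= x <= 1 ->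
  level_average N x <= x <= level_average N x + N%:R^-1.
Proof.
move=> N0 /andP[x0 x1]; have NR : 0 < N%:R :> R by rewrite ltr0n.
pose T := Num.truncn (N%:R * x).
have Nx0 : 0 <= N%:R * x by rewrite mulr_ge0.
have /andP[T1 T2] := truncn_itv Nx0.
have TN : (T <= N)%N.
  rewrite -(ler_nat R); apply: (le_trans T1).
  by rewrite -[leRHS]mulr1 ler_pM2l.
have sumE : \sum_(i < N) ((i.+1%:R / N%:R <= x)%R%:R) = T%:R :> R.
  rewrite (eq_bigr (fun i : 'I_N => ((i < T)%N : nat)%:R)); last first.
    move=> i _; congr (nat_of_bool _)%:R.
    rewrite ler_pdivrMr // mulrC; apply/idP/idP => h.
      by rewrite -(ltr_nat R); have := le_lt_trans h T2; rewrite !ltr_nat ltnS.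
    by apply: le_trans T1; rewrite ler_nat.
  by rewrite -natr_sum sum_ord_lt; congr _%:R; apply/minn_idPr.
rewrite /level_average sumE; apply/andP; split.
  by rewrite ler_pdivrMl.
have -> : N%:R^-1 * T%:R + N%:R^-1 = N%:R^-1 * T.+1%:R :> R.
  by rewrite -[T.+1]addn1 natrD mulrDr mulr1.
by rewrite ler_pdivlMl // ltW.
Qed.

End Mean.

(** * Decorrelation of functions with values in the unit interval *)

Section Decorrelation.
Context (R : realType) d (Omega : measurableType d) (P : probability Omega R).

Lemma bounded_measurable_bool (b : Omega -> bool) :
  measurable_fun setT b -> bounded_measurable (fun w => (b w)%:R : R).
Proof.
move=> mb; split; last first.
  by exists 1 => w; rewrite ger0_norm //; case: (b w).
by apply: (@measurableT_comp _ _ _ _ _ _ (fun c : bool => c%:R : R)).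
Qed.

Lemma mean_mul_le (F G : Omega -> R) (e : R) :
  bounded_measurable F -> bounded_measurable G ->
  (forall w, 0 <= F w <= 1) -> (forall w, 0 <= G w <= 1) ->
  (forall s t, mean P (fun w => (s <= F w)%R%:R * (t <= G w)%R%:R) <=
     mean P (fun w => (s <= F w)%R%:R) * mean P (fun w => (t <= G w)%R%:R) + e) ->
  mean P (fun w => F w * G w) <= mean P F * mean P G + e.
Proof.
move=> bF bG F01 G01 dec; apply/ler_addgt0Pr => eta eta0.
pose N := (Num.truncn (3 / eta)).+1.
have NR : 0 < N%:R :> R by rewrite ltr0n.
have N_ge1 : N%:R^-1 <= 1 :> R by rewrite invf_le1 // ler1n.
have Neta : 3 / N%:R <= eta.
  rewrite ler_pdivrMr // -ler_pdivrMl // mulrC; apply: ltW; exact: truncnS_gt.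
pose lev (K : Omega -> R) (i : 'I_N) w : R := (i.+1%:R / N%:R <= K w)%R%:R.
have blev K : bounded_measurable K -> forall i, bounded_measurable (lev K i).
  move=> [mK _] i; apply: bounded_measurable_bool.
  by apply: measurable_fun_ler => //; exact: measurable_cst.
pose av (K : Omega -> R) w : R := level_average N (K w).
have avE K : av K = fun w => N%:R^-1 * \sum_i lev K i w by [].
have bav K : bounded_measurable K -> bounded_measurable (av K).
  move=> bK; rewrite avE; apply: bounded_measurableM.
    exact: bounded_measurable_cst.
  by apply: bounded_measurable_sum; exact: blev.
have avP K w : 0 <= K w <= 1 -> av K w <= K w <= av K w + N%:R^-1.
  by move=> K01; exact: level_averageP.
have av0 K w : 0 <= av K w.
  by rewrite avE mulr_ge0 ?invr_ge0 ?sumr_ge0 // ltW.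
have step1 : mean P (fun w => F w * G w) <=
    mean P (fun w => av F w * av G w + 3 / N%:R).
  apply: mean_le; first exact: bounded_measurableM.
    apply: bounded_measurableD; last exact: bounded_measurable_cst.
    by apply: bounded_measurableM; exact: bav.
  move=> w; have /andP[f0 f1] := F01 w; have /andP[g0 g1] := G01 w.
  have /andP[f2 f3] := avP F w (F01 w); have /andP[g2 g3] := avP G w (G01 w).
  apply: (@le_trans _ _ ((av F w + N%:R^-1) * (av G w + N%:R^-1))).
    exact: ler_pM.
  have h1 : av F w * N%:R^-1 <= 1 * N%:R^-1.
    by rewrite ler_wpM2r ?invr_ge0 ?(ltW NR) // (le_trans f2).
  have h2 : av G w * N%:R^-1 <= 1 * N%:R^-1.
    by rewrite ler_wpM2r ?invr_ge0 ?(ltW NR) // (le_trans g2).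
  have h3 : N%:R^-1 * N%:R^-1 <= 1 * N%:R^-1 :> R.
    by rewrite ler_wpM2r ?invr_ge0 ?(ltW NR).
  by rewrite mulrDl !mulrDr [N%:R^-1 * av G w]mulrC; lra.
apply: (le_trans step1); rewrite meanD; last 2 first.
- by apply: bounded_measurableM; exact: bav.
- exact: bounded_measurable_cst.
rewrite mean_cst; apply: lerD => //.
have mav K : bounded_measurable K ->
    mean P (av K) = N%:R^-1 * \sum_i mean P (lev K i).
  move=> bK; rewrite avE meanZ ?mean_sum //; first exact: blev.
  by apply: bounded_measurable_sum; exact: blev.
have avle K : bounded_measurable K -> (forall w, 0 <= K w <= 1) ->
    mean P (av K) <= mean P K.
  move=> bK K01; apply: mean_le => // [|w]; first exact: bav.
  by have /andP[] := avP K w (K01 w).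
have mean0 K : bounded_measurable K -> 0 <= mean P (av K).
  move=> bK; rewrite -(mean_cst P 0); apply: mean_le => //.
    exact: bounded_measurable_cst.
  exact: bav.
apply: (@le_trans _ _ (mean P (av F) * mean P (av G) + e)); last first.
  by rewrite lerD2r; apply: ler_pM; rewrite ?mean0 ?avle.
have bll i j : bounded_measurable (fun w => lev F i w * lev G j w).
  by apply: bounded_measurableM; exact: blev.
have -> : (fun w => av F w * av G w) =
    (fun w => (N%:R^-1 * N%:R^-1) * \sum_i \sum_j lev F i w * lev G j w).
  by apply/funext => w; rewrite !avE mulrACA big_distrlr.
rewrite meanZ; last by do 2![apply: bounded_measurable_sum => ?].
rewrite mean_sum; last by move=> i; exact: bounded_measurable_sum.
apply: (@le_trans _ _ (N%:R^-1 * N%:R^-1 *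
    \sum_(i < N) \sum_(j < N) (mean P (lev F i) * mean P (lev G j) + e))).
  apply: ler_wpM2l; first by rewrite mulr_ge0 ?invr_ge0 ?(ltW NR).
  apply: ler_sum => i _; rewrite mean_sum //.
  by apply: ler_sum => j _; exact: dec.
rewrite !mav //; under eq_bigr do rewrite big_split /=.
rewrite big_split /= -big_distrlr /= !sumr_const !card_ord mulrDr mulrACA.
rewrite lerD2l -mulrnA -[e *+ _]mulr_natl natrM mulrA.
by rewrite mulrACA mulVf ?gt_eqF // !mul1r.
Qed.

End Decorrelation.

Section EnvironmentExpectation.
Context (R : realType) (S : ptopologicalType) d (Omega : measurableType d).
Context (P : probability Omega R) (omega : {mfun Omega >-> env S}).
Context (l r : nat) (g : window S l -> R -> int) (gP : jump_function r g).
Context (gamma : R) (gamma_gt0 : 0 < gamma).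
Context (ell : forall e, elliptic gamma (env_kernel g e : kernel R r)).

Definition env_mean (f : kernel R r -> R) : R :=
  mean P (fun w => f (env_kernel g (omega w))).

Lemma polynomial_bounded D (f : kernel R r -> R) : polynomial D f ->
  exists M, forall k, elliptic gamma k -> `|f k| <= M.
Proof.
elim=> [c|n x i _|f1 f2 _ [M1 H1] _ [M2 H2]|f1 f2 _ [M1 H1] _ [M2 H2]].
- by exists `|c|.
- exists 1 => k kP; rewrite ger0_norm ?(kernel_ge0 gamma_gt0 kP) //.
  exact: (kernel_le1 gamma_gt0 kP).
- exists (M1 + M2) => k kP; apply: (le_trans (ler_normD _ _)).
  by apply: lerD; [exact: H1|exact: H2].
- exists (M1 * M2) => k kP; rewrite normrM ler_pM //; [exact: H1|exact: H2].
Qed.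

Lemma polynomial_bounded_measurable D (f : kernel R r -> R) : polynomial D f ->
  bounded_measurable (fun w => f (env_kernel g (omega w))).
Proof.
move=> fp; split; last first.
  by have [M HM] := polynomial_bounded fp; exists M => w; exact: HM.
exact: (measurable_polynomial_everywhere gP (measurable_funPT omega)
  (polynomial_everywhere fp)).
Qed.

Lemma env_mean_shift x0 t0 (f : kernel R r -> R) : translation_invariant P omega ->
  polynomial everywhere f ->
  env_mean (fun k => f (shift_kernel x0 t0 k)) = env_mean f.
Proof.
move=> inv fp; rewrite /env_mean.
pose F (e : env S) := f (env_kernel g e).
have mF : measurable_fun setT F.
  exact: (measurable_polynomial_everywhere gP (@measurable_id _ (env S) setT) fp).
have mS := measurableT_comp (@measurable_shift_env S x0 t0) (measurable_funPT omega).
have [M HM] := polynomial_bounded fp.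
have bF (h : Omega -> env S) : measurable_fun setT h ->
    P.-integrable setT (EFin \o (F \o h)).
  move=> mh; apply: bounded_measurable_integrable; split.
    exact: measurableT_comp mF mh.
  by exists M => w; exact: HM.
have mFE : measurable_fun setT (EFin \o F) by exact/measurable_EFinP.
have -> : (fun w => f (shift_kernel x0 t0 (env_kernel g (omega w)))) =
    (fun w => F (shift_env x0 t0 (omega w))).
  by apply/funext => w; rewrite /F env_kernel_shift.
rewrite /mean /Rintegral; congr fine.
have i1 := @integral_pushforward _ _ _ _ R _ (measurable_funPT omega) P setT _ mFE.
have i2 := @integral_pushforward _ _ _ _ R _ mS P setT _ mFE.
rewrite preimage_setT in i1 i2.
transitivity (\int[pushforward P (shift_env x0 t0 \o omega)]_(e in setT)
  (EFin \o F) e)%E.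
  by rewrite i2 //; exact: (bF _ mS).
transitivity (\int[pushforward P omega]_(e in setT) (EFin \o F) e)%E; last first.
  by rewrite i1 //; exact: (bF _ (measurable_funPT omega)).
pose so : {mfun Omega >-> env S} := HB.pack (shift_env x0 t0 \o omega)
  (isMeasurableFun.Build _ _ _ _ _ mS).
apply: (@eq_measure_integral _ _ _ _ (pushforward P omega) (pushforward P so)).
by move=> A mA _; rewrite [RHS](inv x0 t0 A mA).
Qed.

End EnvironmentExpectation.

(** * The kernel of a mixing environment *)

Section MixingEnvironment.
Context (R : realType) (S : ptopologicalType) d (Omega : measurableType d).
Context (P : probability Omega R) (omega : {mfun Omega >-> env S}).
Context (l r : nat) (g : window S l -> R -> int) (gP : jump_function r g).
Context (gamma : R) (gamma_gt0 : 0 < gamma).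
Context (ell : forall e, elliptic gamma (env_kernel g e : kernel R r)).
Context (c0 alpha : R).
Context (omega_mix : mixing P omega c0 (2 * r + 3)%:R 1 alpha).

Lemma npow4E H : (0 < H)%N ->
  c0 * H%:R `^ (- alpha) = c0 / npow (alpha / 4) H ^+ 4.
Proof.
move=> H0; rewrite powRN /npow -powR_mulrn ?powR_ge0 // -powRrM.
by rewrite divfK.
Qed.

Section Boxes.
Context (a : int) (s H : nat) (lH : (l < H)%N).

Let H_gt0 : (0 : R) < H%:R. Proof. by rewrite ltr0n; lia. Qed.

Let xmin_lt_xmax : (a - l%:Z)%:~R <
  (a + ((2 * r + 1) * H)%:Z + l%:Z + 1)%:~R :> R.
Proof. by rewrite ltr_int; lia. Qed.

Let tmin_lt_tmax : s%:R < (s + H)%:R :> R.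
Proof. by rewrite ltr_nat; lia. Qed.

(** The walk at a site reads the environment up to distance [l], hence the
    margin. *)
Definition enlarged_box : box R := Box xmin_lt_xmax tmin_lt_tmax.

Lemma enlarged_box_diam : box_diam enlarged_box <= (2 * r + 3)%:R * H%:R.
Proof.
rewrite /box_diam /= -rmorphB /= -natrM -[_%:R]/((_ : nat)%:Z%:~R) ler_int.
by lia.
Qed.

Lemma enlarged_box_height : box_height enlarged_box <= 1 * H%:R.
Proof. by rewrite /box_height /= natrD mul1r addrAC subrr add0r. Qed.

Lemma enlarged_box_sites n x y : in_box a (a + ((2 * r + 1) * H)%:Z) s (s + H) n x ->
  x - l%:Z <= y <= x + l%:Z -> box_sites enlarged_box (y, n).
Proof.
move=> [x1 n1] y1; rewrite /box_sites /= ler_int ltr_int ler_nat ltr_nat.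
by split; lia.
Qed.

End Boxes.

Lemma enlarged_box_sep a a' s s' H (lH : (l < H)%N) : (s + 2 * H <= s')%N ->
  H%:R <= box_sep (enlarged_box a s lH) (enlarged_box a' s' lH).
Proof.
move=> ss'; rewrite /box_sep /= !ltr_nat.
rewrite ifF; last by apply/negbTE; lia.
rewrite ifT; last by lia.
by rewrite lerBrDr -natrD ler_nat; lia.
Qed.

Lemma env_mean_kernel_expectation : translation_invariant P omega ->
  kernel_expectation gamma l (fun H => c0 / npow (alpha / 4) H ^+ 4)
    (env_mean P omega g (r := r)).
Proof.
move=> inv; have bm D (f : kernel R r -> R) (fp : polynomial D f) :=
  polynomial_bounded_measurable omega gP gamma_gt0 ell fp.
split.
- by move=> c; exact: mean_cst.
- by move=> f1 f2 fp1 fp2; exact: meanD (bm _ _ fp1) (bm _ _ fp2).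
- by move=> c f fp; exact: meanZ (bm _ _ fp).
- by move=> f1 f2 fp1 fp2 f12; apply: mean_le => [||w];
    [exact: bm fp1|exact: bm fp2|exact: f12].
- by move=> x0 t0 f fp; exact: (env_mean_shift gP gamma_gt0 ell).
move=> H a a' s s' f1 f2 lH ss' fp1 fp2 f01 f02.
apply: mean_mul_le => [||w|w|t1 t2];
  [exact: bm fp1|exact: bm fp2|exact: f01|exact: f02|].
have H0 : (0 < H)%N by lia.
have HR : 0 < H%:R :> R by rewrite ltr0n.
have loc aa ss (f : kernel R r -> R) t :
    polynomial (in_box aa (aa + ((2 * r + 1) * H)%:Z) ss (ss + H)) f ->
    restr_measurable omega (box_sites (enlarged_box aa ss lH))
      ((fun e => t <= f (env_kernel g e)) \o omega).
  move=> fp; apply: measurable_fun_ler; first exact: measurable_cst.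
  apply: (measurable_polynomial gP _ fp) => n x Dnx y xy.
  exact: enlarged_box_sites Dnx xy.
have := omega_mix HR _ _ (enlarged_box_sep a a' lH ss')
  (loc a s f1 t1 fp1) (loc a' s' f2 t2 fp2).
have bb D (f : kernel R r -> R) t : polynomial D f ->
    bounded_measurable (fun w => (t <= f (env_kernel g (omega w)))%R%:R : R).
  move=> /bm[mf _]; apply: bounded_measurable_bool.
  by apply: measurable_fun_ler => //; exact: measurable_cst.
have b1 := bb _ f1 t1 fp1; have b2 := bb _ f2 t2 fp2.
have b12 := bounded_measurableM b1 b2.
rewrite (expectation_mean P b12) (expectation_mean P b1) (expectation_mean P b2).
rewrite -EFinM -EFinD lee_fin npow4E //; apply.
- by rewrite ge_max !enlarged_box_diam.
- by rewrite ge_max !enlarged_box_height.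
Qed.

End MixingEnvironment.

(** * The law of the walk in a fixed environment *)

Section QuenchedLaw.
Context (R : realType) (S : ptopologicalType) d' (Omega' : measurableType d').
Context (P' : probability Omega' R) (l r : nat) (g : window S l -> R -> int).
Context (gP : jump_function r g) (U : nat * int -> {RV P' >-> R}).
Context (U01 : forall i w, U i w \in `[0, 1]).
Context (U_unif : forall i (A : set R), measurable A ->
  distribution P' (U i) A = uniform_prob (@ltr01 R) A).
Context (U_indep : mutually_independent U) (e : env S).

Let k : kernel R r := env_kernel g e.
Let X (n : nat) (w : Omega') : int := walk g e (fun m x => U (m, x) w) n.

(** Trajectories are given by their jumps, the last one first, so that they are
    extended by [cons]. *)
Fixpoint position (js : seq 'I_(r.*2.+1)) : int :=
  if js is i :: js' then position js' + jump i else 0.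

Fixpoint visited (js : seq 'I_(r.*2.+1)) : seq (nat * int) :=
  if js is i :: js' then (size js', position js') :: visited js' else [::].

Let jump_event (i : 'I_(r.*2.+1)) (p : nat * int) : set R :=
  `[0, 1] `&` [set u | g (view e p.1 p.2) u = jump i].

Fixpoint demand (js : seq 'I_(r.*2.+1)) (p : nat * int) : set R :=
  if js is i :: js' then
    if p.1 == size js' then jump_event i p else demand js' p
  else setT.

(** [demand js] requires of the uniform variables at the visited sites that they
    produce the jumps [js]. *)
Definition cylinder (js : seq 'I_(r.*2.+1)) : set Omega' :=
  \bigcap_(p in [set` visited js]) (U p @^-1` demand js p).

Fixpoint weight (js : seq 'I_(r.*2.+1)) : R :=
  if js is i :: js' then k (size js') (position js') i * weight js' else 1.

Lemma visited_size js p : p \in visited js -> (p.1 < size js)%N.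
Proof.
elim: js => //= i js IH; rewrite inE => /orP[/eqP -> //|/IH].
exact: ltnW.
Qed.

Lemma visited_uniq js : uniq (visited js).
Proof.
elim: js => //= i js ->; rewrite andbT; apply/negP => /visited_size /=.
by rewrite ltnn.
Qed.

Lemma demand_visited i js p : p \in visited js ->
  demand (i :: js) p = demand js p.
Proof. by move=> /visited_size /= /ltn_eqF ->. Qed.

Lemma measurable_demand js p : measurable (demand js p).
Proof.
elim: js => //= i js IH; case: ifP => // _.
exact: (measurable_jump_event gP).
Qed.

Lemma cylinder_cons i js : cylinder (i :: js) =
  (U (size js, position js) @^-1` jump_event i (size js, position js))
    `&` cylinder js.
Proof.
apply/seteqP; split=> w.
  move=> Hw; split.
    by have := Hw (size js, position js); rewrite /= inE !eqxx; apply.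
  move=> p /= pjs; have := Hw p; rewrite (demand_visited _ pjs); apply.
  by rewrite /= inE pjs orbT.
move=> [H1 H2] p /=; rewrite inE => /orP[/eqP -> /=|pjs].
  by rewrite eqxx.
by rewrite /= (ltn_eqF (visited_size pjs)); exact: H2 p pjs.
Qed.

Lemma measurable_cylinder js : measurable (cylinder js).
Proof.
elim: js => [|i js IH].
  by rewrite /cylinder /= set_nil bigcap_set0.
rewrite cylinder_cons; apply: measurableI => //.
rewrite -[X in measurable X]setTI; apply: measurable_funPT => //.
exact: (measurable_jump_event gP).
Qed.

(** A trajectory visits each time once, so the uniform variables that it uses
    have distinct indices and are independent. *)
Lemma cylinder_prob js : P' (cylinder js) = (weight js)%:E.
Proof.
rewrite /cylinder U_indep ?visited_uniq //; last first.
  by move=> p _; exact: measurable_demand.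
elim: js => [|i js IH]; first by rewrite big_nil.
rewrite [visited _]/= big_cons (eq_big_seq (fun p => P' (U p @^-1` demand js p))).
  rewrite IH [RHS]EFinM; congr (_ * _)%E; rewrite /= eqxx.
  transitivity (distribution P' (U (size js, position js))
    (jump_event i (size js, position js))) => //.
  rewrite U_unif; last exact: (measurable_jump_event gP).
  by rewrite /k /env_kernel fineK ?(jump_prob_fin gP).
by move=> p pjs; rewrite demand_visited.
Qed.

Lemma walk_cylinder js w : cylinder js w -> X (size js) w = position js.
Proof.
elim: js => // i js IH; rewrite cylinder_cons => -[[_ /= gi] /IH Xjs].
by rewrite /X /= in Xjs *; rewrite Xjs gi.
Qed.

Lemma cylinder_split js (B : set Omega') : cylinder js `&` B =
  \big[setU/set0]_(i < r.*2.+1) (cylinder (i :: js) `&` B).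
Proof.
rewrite -bigcup_seq; apply/seteqP; split=> w.
  move=> [wjs Bw]; pose p := (size js, position js).
  have [i Hi] := jump_surj (gP.1 (view e p.1 p.2) _ (U01 p w)).
  exists i; first by rewrite /= mem_index_enum.
  by split=> //; rewrite cylinder_cons; split=> //; split; [exact: U01|].
by move=> [i _ [+ Bw]]; rewrite cylinder_cons => -[_ ?].
Qed.

(** Summing over the next jump is the recursion that defines [quenched].  The
    measurability comes along, because the events are finite unions of
    cylinders. *)
Lemma cylinder_prob_walk H js (phi : int -> bool) :
  let B := cylinder js `&` [set w | phi (X (size js + H) w)] in
  measurable B /\
  P' B = (weight js * quenched k H (size js) (fun y => (phi y)%:R) (position js))%:E.
Proof.
elim: H js => [|H IH] js /=.
  rewrite addn0 (_ : _ `&` _ = if phi (position js) then cylinder js else set0).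
    case: (phi _); first by rewrite mulr1 cylinder_prob; split;
      first exact: measurable_cylinder.
    by rewrite mulr0 measure0; split.
  apply/seteqP; split=> w.
    by move=> [wjs] /=; rewrite (walk_cylinder wjs) => ->.
  by case: ifP => // pp wjs; split => //=; rewrite (walk_cylinder wjs).
have mB i := (IH (i :: js)).1.
rewrite /= in mB; rewrite cylinder_split addnS.
have tB : trivIset setT (fun i : 'I_(r.*2.+1) =>
    cylinder (i :: js) `&` [set w | phi (X (size js + H).+1 w)]).
  move=> i j _ _ [w [[+ _] [+ _]]]; rewrite !cylinder_cons.
  move=> [[_ /= gi] _] [[_ /= gj] _]; apply/val_inj.
  have : jump i = jump j by rewrite -gi -gj.
  by rewrite /jump /=; lia.
split; first by apply: bigsetU_measurable => i _; rewrite -addSn; exact: mB.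
rewrite (measure_bigsetU_ord P' predT) //.
rewrite (eq_bigr (fun i => (weight (i :: js) * quenched k H (size js).+1
    (fun y => (phi y)%:R) (position (i :: js)))%:E)); last first.
  by move=> i _; exact: (IH (i :: js)).2.
rewrite sumEFin mulr_sumr; congr (_%:E); apply: eq_bigr => i _.
by rewrite -mulrA mulrCA.
Qed.

Lemma walk_prob n (phi : int -> bool) :
  P' [set w | phi (X n w)] = (quenched k n 0 (fun y => (phi y)%:R) 0)%:E.
Proof.
have [_] := cylinder_prob_walk n [::] phi.
by rewrite /= mul1r => <-; rewrite /cylinder /= set_nil bigcap_set0 setTI.
Qed.

End QuenchedLaw.

(** * Measurability and almost sure convergence *)

Section WalkMeasurability.
Context (R : realType) (S : ptopologicalType) (d d' : measure_display).
Context (Omega : measurableType d).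
Context (Omega' : measurableType d') (P' : probability Omega' R).
Context (omega : {mfun Omega >-> env S}).
Context (l r : nat) (g : window S l -> R -> int) (gP : jump_function r g).
Context (U : nat * int -> {RV P' >-> R}) (U01 : forall i w, U i w \in `[0, 1]).

Let X (n : nat) (w : Omega * Omega') : int :=
  walk g (omega w.1) (fun m x => U (m, x) w.2) n.

Lemma measurable_view_environment n x :
  measurable_fun setT (fun w => view (omega w) n x : window S l).
Proof.
move=> _ B mB.
apply: (@restr_gen_measurable _ _ _ omega setT (measurable_funPT omega)).
exact: (@measurable_view S l _ _ omega setT n x (fun _ _ => I)).
Qed.

Lemma measurable_step n z x :
  measurable [set w : Omega * Omega' |
    g (view (omega w.1) n z) (U (n, z) w.2) = x].
Proof.
pose h (w : Omega * Omega') : window S l * measurableTypeR R :=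
  (view (omega w.1) n z, U (n, z) w.2).
have mh : measurable_fun setT h.
  apply: measurable_fun_pair.
    exact: (measurableT_comp (measurable_view_environment n z) measurable_fst).
  exact: (measurableT_comp (measurable_funPT (U (n, z))) measurable_snd).
have := mh measurableT _ (gP.2 x); rewrite setTI.
congr (measurable _); apply/seteqP; split=> w /=; first by case.
by move=> gx; split=> //; split=> //; exact: U01.
Qed.

Lemma measurable_walk_eq n x : measurable [set w | X n w = x].
Proof.
elim: n x => [|n IH] x.
  have [<-|x0] := eqVneq 0 x.
    by rewrite (_ : [set _ | _] = setT) //; apply/seteqP; split.
  rewrite (_ : [set _ | _] = set0) //; apply/seteqP; split=> // w /= /eqP.
  by rewrite /X /= (negbTE x0).
rewrite (_ : [set _ | _] = \bigcup_(z : int) ([set w | X n w = z] `&`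
    [set w | g (view (omega w.1) n z) (U (n, z) w.2) = x - z])).
  apply: countable_bigcupT_measurable => [|z]; first exact: countableP.
  by apply: measurableI; [exact: IH|exact: measurable_step].
apply/seteqP; split=> w /=.
  move=> Xx; exists (X n w) => //; split=> //=.
  by rewrite -Xx /X /= addrAC subrr add0r.
by move=> [z _ [/= <- gx]]; rewrite /X /= -/(X n w) gx addrC subrK.
Qed.

Lemma measurable_walk_event n (phi : int -> bool) :
  measurable [set w | phi (X n w)].
Proof.
rewrite (_ : [set _ | _] = \bigcup_(z : int)
    ([set w | X n w = z] `&` [set w | phi z])).
  apply: countable_bigcupT_measurable => [|z]; first exact: countableP.
  apply: measurableI.
    exact: measurable_walk_eq.
  case: (phi z).
    by rewrite (_ : [set _ | _] = setT) //; apply/seteqP; split.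
  by rewrite (_ : [set _ | _] = set0) //; apply/seteqP; split.
apply/seteqP; split=> w /=; first by exists (X n w).
by move=> [z _ [/= ->]].
Qed.

End WalkMeasurability.

Section BorelCantelli.
Context (R : realType) d (T : measurableType d).
Context (mu : {measure set T -> \bar R}).

Lemma inverse_square_sum_le n :
  \sum_(0 <= i < n.+1) (i.+1%:R ^- 2 : R) <= 2 - n.+1%:R^-1.
Proof.
elim: n => [|n IH]; first by rewrite big_nat1 expr1n invr1; lra.
rewrite big_nat_recr //=.
have n1 : 0 < n.+1%:R :> R by rewrite ltr0n.
have n2 : 0 < n.+2%:R :> R by rewrite ltr0n.
have : n.+2%:R ^- 2 <= n.+1%:R^-1 - n.+2%:R^-1 :> R.
  have -> : n.+1%:R^-1 - n.+2%:R^-1 = (n.+1%:R * n.+2%:R)^-1 :> R.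
    have e : n.+2%:R = n.+1%:R + 1 :> R by rewrite natr1.
    by rewrite e in n2 *; field; rewrite !gt_eqF.
  rewrite lef_pV2 ?posrE ?mulr_gt0 ?exprn_gt0 // expr2 ler_pM2r // ler_nat.
  exact: leqnSn.
by move=> h; apply: (le_trans (lerD IH h)); rewrite addrA subrK.
Qed.

(** The deviation bounds are summable because [theta >= 2]. *)
Lemma cvg_ae_of_deviation_le (Y : nat -> T -> R) (nu theta : R) : 2 <= theta ->
  (forall eps n, measurable [set w | eps <= `|Y n w - nu|]) ->
  (forall eps, 0 < eps -> exists2 c, 0 < c & forall n, (1 <= n)%N ->
     (mu [set w | (eps <= `|Y n w - nu|)%R] <= (c * n%:R `^ (- theta))%:E)%E) ->
  {ae mu, forall w, (fun n => Y n w) @ \oo --> nu}.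
Proof.
move=> theta2 mY dev.
pose F (j n : nat) := [set w | j.+1%:R^-1 <= `|Y n.+1 w - nu|].
have F0 j : mu (lim_sup_set (F j)) = 0%E.
  apply: lim_sup_set_cvg0; first by move=> n; exact: mY.
  have [c c0 Hc] := dev j.+1%:R^-1 ltac:(by rewrite invr_gt0 ltr0n).
  apply: (@le_lt_trans _ _ (c * 2)%:E); last exact: ltry.
  apply: lime_le; first exact: is_cvg_nneseries.
  apply: nearW => n.
  apply: (@le_trans _ _ (\sum_(0 <= i < n) (c * i.+1%:R ^- 2)%:E)%E).
    apply: lee_sum => i _; apply: (le_trans (Hc i.+1 isT)).
    rewrite lee_fin ler_pM2l // -powR_invn //.
    by apply: ler_powR; [rewrite ler1n|lra].
  rewrite sumEFin lee_fin -mulr_sumr ler_pM2l //.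
  case: n => [|n]; first by rewrite big_nil.
  by apply: (le_trans (inverse_square_sum_le n)); rewrite gerBl.
have : mu.-negligible (\bigcup_j lim_sup_set (F j)).
  apply: negligible_bigcup => j; apply/negligibleP; last exact: F0.
  apply: bigcapT_measurable => n; apply: bigcup_measurable => m _.
  exact: mY.
move=> neg; apply: (negligibleS _ neg) => w /= ncvg.
apply: contrapT => nbad; apply: ncvg.
apply/cvgrPdist_lt => eps eps0.
pose j := Num.truncn eps^-1.
have je : j.+1%:R^-1 < eps.
  rewrite invf_plt ?posrE ?ltr0n //; exact: truncnS_gt.
have [N HN] : exists N, forall n, (N <= n)%N -> `|Y n.+1 w - nu| < j.+1%:R^-1.
  apply: contrapT => noN; apply: nbad; exists j => // n _.
  apply: contrapT => nF; apply: noN; exists n => m nm.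
  by rewrite ltNge; apply/negP => Fm; apply: nF; exists m.
exists N.+1 => // -[//|n] /= Nn.
by rewrite distrC; apply: lt_trans je; exact: HN.
Qed.

End BorelCantelli.

(** * The law of large numbers *)

(** A deviation is a large displacement of the walk or of its reflection. *)
Lemma deviation_le_fast_prob (R : realType) (r : nat) (gamma : R) (l : nat)
    (err : nat -> R) (E : (kernel R r -> R) -> R) (n : nat) (nu eps : R) :
  0 < gamma -> kernel_expectation gamma l err E -> (1 <= n)%N ->
  E (fun k => quenched k n 0
       (fun y => (eps <= `|y%:~R / n%:R - nu|)%R%:R) 0) <=
  fast_prob E n (nu + eps) +
  fast_prob (fun f => E (fun k => f (flip_kernel k))) n (- nu + eps).
Proof.
move=> gamma0 EP n1; have nR : 0 < n%:R :> R by rewrite ltr0n.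
have pflip : polynomial everywhere (fun k : kernel R r =>
    ahead (flip_kernel k) n 0 0 ((- nu + eps) * n%:R)).
  exact: polynomial_everywhere
    (polynomial_flip (@polynomial_ahead_everywhere R r n 0 0 ((- nu + eps) * n%:R))).
rewrite -(expectD EP) //; last exact: polynomial_ahead_everywhere.
apply: (expect_le EP).
- exact: polynomial_everywhere (polynomial_quenched _ _ _ _ _).
- by apply: polynomialD => //; exact: polynomial_ahead_everywhere.
move=> k kP; rewrite /ahead quenched_flip oppr0 -quenchedD.
apply: (quenched_le gamma0 kP) => y _.
have [dev|_] := lerP eps `|y%:~R / n%:R - nu|; last by rewrite addr_ge0.
move: dev; rewrite ler_normr => /orP[dev|dev].
- have -> : (nu + eps) * n%:R <= y%:~R by rewrite -ler_pdivlMr //; lra.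
  by rewrite lerDl.
- have -> : (- nu + eps) * n%:R <= (- y)%:~R.
    by rewrite -ler_pdivlMr // mulrNz mulNr; lra.
  by rewrite lerDr.
Qed.

Theorem theorem2p7 (R : realType) (S : ptopologicalType)
    (d d' : measure_display)
    (Omega : measurableType d) (P : probability Omega R)
    (Omega' : measurableType d') (P' : probability Omega' R)
    (omega : {mfun Omega >-> env S})
    (l r : nat) (l_gt0 : (0 < l)%N) (r_gt0 : (0 < r)%N)
    (g : window S l -> R -> int) (gP : jump_function r g)
    (U : nat * int -> {RV P' >-> R})
    (U01 : forall i w, U i w \in `[0, 1])
    (U_unif : forall i (A : set R), measurable A ->
       distribution P' (U i) A = uniform_prob (@ltr01 R) A)
    (U_indep : mutually_independent U)
    (omega_inv : translation_invariant P omega)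
    (g_ell : uniformly_elliptic r g)
    (c0 alpha : R) (c0_gt0 : 0 < c0) (alpha_gt11 : 11 < alpha)
    (omega_mix : mixing P omega c0 (2 * r + 3)%:R 1 alpha) :
  let X (n : nat) (w : Omega * Omega') : int :=
    walk g (omega w.1) (fun m x => U (m, x) w.2) n in
  exists nu : R,
    [/\ - r%:R <= nu <= r%:R,
        {ae (P \x P')%E, forall w,
           (fun n : nat => (X n w)%:~R / n%:R : R) @ \oo --> nu} &
        forall eps : R, 0 < eps ->
        exists2 c : R, 0 < c &
        forall n : nat, (1 <= n)%N ->
          ((P \x P') [set w | (eps <= `|(X n w)%:~R / n%:R - nu|)%R]
           <= (c * n%:R `^ (- (alpha / 4)))%:E)%E].
Proof.
move=> X.
have [gamma gamma_gt0 ell] := env_kernel_elliptic gP g_ell.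
have EP := env_mean_kernel_expectation gP gamma_gt0 ell omega_mix omega_inv.
have theta_ge2 : 2 <= alpha / 4 by lra.
have [nu nur dec] := speed_exists theta_ge2 r_gt0 gamma_gt0 (ltW c0_gt0) EP.
have law n (phi : int -> bool) : (P \x P')%E [set w | phi (X n w)] =
    (env_mean P omega g (fun k : kernel R r =>
       quenched k n 0 (fun y => (phi y)%:R) 0))%:E.
  rewrite /env_mean -expectation_mean; last first.
    exact: (polynomial_bounded_measurable omega gP gamma_gt0 ell
      (polynomial_quenched _ _ _ _ _)).
  rewrite unlock; apply: eq_integral => w _ /=.
  rewrite -(walk_prob gP U01 U_unif U_indep (omega w)); congr (P' _).
  by apply/seteqP; split=> w'; rewrite /xsection /= inE.
have dev eps : 0 < eps -> exists2 c : R, 0 < c & forall n : nat, (1 <= n)%N ->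
    ((P \x P') [set w | (eps <= `|(X n w)%:~R / n%:R - nu|)%R]
     <= (c * n%:R `^ (- (alpha / 4)))%:E)%E.
  move=> eps0; have [[c1 c10 H1] [c2 c20 H2]] := dec eps eps0.
  exists (c1 + c2) => [|n n1]; first exact: addr_gt0.
  rewrite (law n (fun y => eps <= `|y%:~R / n%:R - nu|)) lee_fin powRN mulrDl.
  apply: le_trans (deviation_le_fast_prob nu eps gamma_gt0 EP n1) _.
  by apply: lerD; [exact: H1|exact: H2].
exists nu; split => //.
apply: (cvg_ae_of_deviation_le (theta := alpha / 4)) => // eps n.
exact: (measurable_walk_event omega gP U01 n
  (fun y => eps <= `|y%:~R / n%:R - nu|)).
Qed.
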